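(* Let $G$ be a second countable locally compact group and $\Gamma\subseteq G$ a closed subgroup (with fixed left Haar measures $\mu_G,\mu_\Gamma$, rho function $\rho$, measure $\mu_{G/\Gamma}$, and Borel sections $\tau$ of $G/\Gamma$ and $\gamma$ of $\Gamma\backslash G$ as described in the context). There is a unique positive regular Borel measure $\mu_{\Gamma\backslash G}$ on $\Gamma\backslash G$ such that $$\int_Gf(x)\,d\mu_G(x)=\int_{\Gamma\backslash G}\int_\Gamma f(\xi\gamma(\Gamma x))\,d\mu_\Gamma(\xi)\,d\mu_{\Gamma\backslash G}(\Gamma x)$$ for all $f\in L^1(G)$. In particular, $\xi\mapsto f(\xi\gamma(\Gamma x))$ belongs to $L^1(\Gamma)$ for $\mu_{\Gamma\backslash G}$-a.e. $\Gamma x\in\Gamma\backslash G$, and the function $\Gamma x\mapsto\int_\Gamma f(\xi\gamma(\Gamma x))\,d\mu_\Gamma(\xi)$ is measurable on $\Gamma\backslash G$. If $\varepsilon\colon\Gamma\backslash G\to G/\Gamma$ is the homeomorphism $\varepsilon(\Gamma x)=x^{-1}\Gamma$, then $$\int_{\Gamma\backslash G}f(\Gamma x)\,d\mu_{\Gamma\backslash G}(\Gamma x)=\int_{G/\Gamma}f(\varepsilon^{-1}(x\Gamma))\,\frac{1}{\rho(\tau(x\Gamma))\,\Delta_G(\tau(x\Gamma))}\,d\mu_{G/\Gamma}(x\Gamma)$$ for $f\in L^1(\Gamma\backslash G)$.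
   Context: Neither $G$ nor $\Gamma$ need be abelian. $G/\Gamma$ is the space of left cosets, $\Gamma\backslash G$ the space of right cosets. $\mu_G,\mu_\Gamma$ are left Haar measures with fixed scale. $\Delta_G\colon G\to(0,\infty)$ is the modular function normalized by $\int_Gf(xy)\,d\mu_G(x)=\Delta_G(y^{-1})\int_Gf(x)\,d\mu_G(x)$; similarly $\Delta_\Gamma$ for $\Gamma$. A rho function for $(G,\Gamma)$ is a continuous map $\rho\colon G\to(0,\infty)$ with $\rho(x\xi)=\rho(x)\Delta_\Gamma(\xi)/\Delta_G(\xi)$ for all $x\in G$, $\xi\in\Gamma$; one is fixed, taking $\rho=1$ if possible. $\mu_{G/\Gamma}$ is the unique positive regular Borel measure on $G/\Gamma$ with $$\int_Gf(x)\rho(x)\,d\mu_G(x)=\int_{G/\Gamma}\int_\Gamma f(x\xi)\,d\mu_\Gamma(\xi)\,d\mu_{G/\Gamma}(x\Gamma)\qquad\text{for all }f\in C_c(G).$$ $\tau\colon G/\Gamma\to G$ is a fixed Borel section: a Borel map with $\tau(x\Gamma)\in x\Gamma$ for every coset, such that $\tau(K)$ has compact closure in $G$ whenever $K\subseteq G/\Gamma$ is compact. The map $\gamma\colon\Gamma\backslash G\to G$ is the associated Borel section $\gamma(\Gamma x)=[\tau(x^{-1}\Gamma)]^{-1}$. *)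

(* Defs.v *)
From HB Require Import structures.
From mathcomp Require Import all_boot all_order all_algebra.
From mathcomp Require Import complex.
From mathcomp Require Import all_classical all_reals all_analysis.

Set Implicit Arguments.
Unset Strict Implicit.
Unset Printing Implicit Defensive.

Import Order.TTheory GRing.Theory Num.Theory.
Import numFieldNormedType.Exports.

Local Open Scope classical_set_scope.
Local Open Scope ring_scope.
Local Open Scope complex_scope.
Local Open Scope quotient_scope.

(* The distinguished point carried by a topGroupType is arbitrary: it is there
   because measurable types have to be pointed. *)
HB.mixin Record isTopGroup G & Group G & PointedTopological G := {
  mulg_continuous : continuous (fun p : G * G => (p.1 * p.2)%g) ;
  invg_continuous : continuous (fun x : G => (x^-1)%g)
}.

#[short(type="topGroupType")]
HB.structure Definition TopGroup :=
  {G of Group G & PointedTopological G & isTopGroup G}.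

Record closedSubgroup (G : topGroupType) := ClosedSubgroup {
  csg_set :> set G ;
  csg1 : csg_set 1%g ;
  csgM : forall x y, csg_set x -> csg_set y -> csg_set (x * y)%g ;
  csgV : forall x, csg_set x -> csg_set (x^-1)%g ;
  csg_closed : closed csg_set
}.

Section subgroup_type.
Variables (G : topGroupType) (Gam : closedSubgroup G).

Fact csg_group_closed : group_closed (fun x : G => x \in csg_set Gam).
Proof.
split; first by rewrite unfold_in; apply/mem_set; exact: csg1.
move=> x y; rewrite !unfold_in => /set_mem Gx /set_mem Gy.
by apply/mem_set; apply: csgM => //; exact: csgV.
Qed.

Definition csg_type := {x : G | x \in csg_set Gam}.

HB.instance Definition _ := SubChoice.on csg_type.
HB.instance Definition _ :=
  SubChoice_isSubGroup.Build G (fun x : G => x \in csg_set Gam)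
    csg_type csg_group_closed.
HB.instance Definition _ := Topological.copy csg_type (set_type (csg_set Gam)).
HB.instance Definition _ := isPointed.Build csg_type 1%g.

Lemma csg_val_continuous : continuous (val : csg_type -> G).
Proof. exact: (@initial_continuous (set_type (csg_set Gam)) G set_val). Qed.

Fact csg_mulg_continuous :
  continuous (fun p : csg_type * csg_type => (p.1 * p.2)%g).
Proof.
apply: (@continuous_comp_initial csg_type (csg_type * csg_type)%type G val).
have -> : (val : csg_type -> G) \o (fun p : csg_type * csg_type => (p.1 * p.2)%g) =
    (fun p : G * G => (p.1 * p.2)%g) \o
    (fun p : csg_type * csg_type => (val p.1, val p.2)).
  by apply/funext.
move=> p; apply: continuous_comp; last exact: mulg_continuous.
apply: cvg_pair; apply: continuous_comp; try exact: csg_val_continuous.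
- exact: cvg_fst.
- exact: cvg_snd.
Qed.

Fact csg_invg_continuous : continuous (fun x : csg_type => (x^-1)%g).
Proof.
apply: (@continuous_comp_initial csg_type csg_type G val).
have -> : (val : csg_type -> G) \o (fun x : csg_type => (x^-1)%g) =
    (fun x : G => (x^-1)%g) \o val by apply/funext.
move=> p; apply: continuous_comp; last exact: invg_continuous.
exact: csg_val_continuous.
Qed.

HB.instance Definition _ :=
  isTopGroup.Build csg_type csg_mulg_continuous csg_invg_continuous.

End subgroup_type.

Section coset_spaces.
Variables (G : topGroupType) (Gam : closedSubgroup G).

Let cosetP (u v : G) : csg_set Gam (u^-1 * v)%g <-> csg_set Gam (v^-1 * u)%g.
Proof. by split=> /csgV; rewrite invgM invgK. Qed.

Definition lcoset_rel : rel G := fun x y => ((x^-1 * y)%g \in csg_set Gam).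

Fact lcoset_rel_refl : reflexive lcoset_rel.
Proof. by move=> x; apply/mem_set; rewrite mulVg; exact: csg1. Qed.

Fact lcoset_rel_sym : symmetric lcoset_rel.
Proof. by move=> x y; apply/idP/idP => /set_mem/cosetP/mem_set. Qed.

Fact lcoset_rel_trans : transitive lcoset_rel.
Proof.
move=> y x z /set_mem xy /set_mem yz; apply/mem_set.
by have := csgM xy yz; rewrite mulgA mulgK.
Qed.

Canonical lcoset_equiv :=
  EquivRel lcoset_rel lcoset_rel_refl lcoset_rel_sym lcoset_rel_trans.

Definition rcoset_rel : rel G := fun x y => ((x * y^-1)%g \in csg_set Gam).

Fact rcoset_rel_refl : reflexive rcoset_rel.
Proof. by move=> x; apply/mem_set; rewrite mulgV; exact: csg1. Qed.

Fact rcoset_rel_sym : symmetric rcoset_rel.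
Proof.
by move=> x y; apply/idP/idP => /set_mem/csgV;
  rewrite invgM invgK => /mem_set.
Qed.

Fact rcoset_rel_trans : transitive rcoset_rel.
Proof.
move=> y x z /set_mem xy /set_mem yz; apply/mem_set.
by have := csgM xy yz; rewrite mulgA mulgVK.
Qed.

Canonical rcoset_equiv :=
  EquivRel rcoset_rel rcoset_rel_refl rcoset_rel_sym rcoset_rel_trans.

(* lcosets is G / Gamma (cosets x Gamma), rcosets is Gamma \ G. *)
Definition lcosets := quotient_topology {eq_quot lcoset_rel}.
Definition rcosets := quotient_topology {eq_quot rcoset_rel}.

HB.instance Definition _ := PointedTopological.on lcosets.
HB.instance Definition _ := Quotient.on lcosets.
HB.instance Definition _ := PointedTopological.on rcosets.
HB.instance Definition _ := Quotient.on rcosets.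

Definition eps (q : rcosets) : lcosets := \pi_lcosets (repr q)^-1%g.
Definition eps_inv (q : lcosets) : rcosets := \pi_rcosets (repr q)^-1%g.

Lemma lcosetP (x y : G) :
  reflect (\pi_lcosets x = \pi_lcosets y) ((x^-1 * y)%g \in csg_set Gam).
Proof. exact: (@eqmodP _ lcoset_equiv x y). Qed.

Lemma rcosetP (x y : G) :
  reflect (\pi_rcosets x = \pi_rcosets y) ((x * y^-1)%g \in csg_set Gam).
Proof. exact: (@eqmodP _ rcoset_equiv x y). Qed.

Lemma eps_pi (x : G) : eps (\pi_rcosets x) = \pi_lcosets (x^-1)%g.
Proof. by apply/lcosetP; rewrite invgK; apply/rcosetP; rewrite reprK. Qed.

Lemma eps_inv_pi (x : G) : eps_inv (\pi_lcosets x) = \pi_rcosets (x^-1)%g.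
Proof. by apply/rcosetP; rewrite invgK; apply/lcosetP; rewrite reprK. Qed.

Lemma epsK : cancel eps eps_inv.
Proof. by move=> q; rewrite -[q]reprK eps_pi eps_inv_pi invgK. Qed.

Lemma eps_invK : cancel eps_inv eps.
Proof. by move=> q; rewrite -[q]reprK eps_inv_pi eps_pi invgK. Qed.

Lemma eps_continuous : continuous eps.
Proof.
apply/quotient_continuous.
have -> : eps \o \pi_rcosets = \pi_lcosets \o (fun x : G => x^-1%g).
  by apply/funext => x /=; exact: eps_pi.
move=> x; apply: continuous_comp; first exact: invg_continuous.
exact: pi_continuous.
Qed.

Lemma eps_inv_continuous : continuous eps_inv.
Proof.
apply/quotient_continuous.
have -> : eps_inv \o \pi_lcosets = \pi_rcosets \o (fun x : G => x^-1%g).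
  by apply/funext => x /=; exact: eps_inv_pi.
move=> x; apply: continuous_comp; first exact: invg_continuous.
exact: pi_continuous.
Qed.

End coset_spaces.

Notation borel T := (g_sigma_algebraType (@open T)).

Section measures.
Variable R : realType.

(* R[i] carries the topology of its norm only when it is seen as a
   numFieldType. *)
Definition Ctop : topologicalType := (R[i] : numFieldType).

Definition cintegrable d (T : measurableType d)
    (mu : {measure set T -> \bar R}) (f : T -> R[i]) :=
  mu.-integrable setT (EFin \o (fun x => complex.Re (f x))) /\
  mu.-integrable setT (EFin \o (fun x => complex.Im (f x))).

Definition cmeasurable d (T : measurableType d) (f : T -> R[i]) :=
  measurable_fun setT (fun x => complex.Re (f x)) /\
  measurable_fun setT (fun x => complex.Im (f x)).

(* Total: it only has its usual meaning when [cintegrable mu f]. *)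
Definition cintegral d (T : measurableType d)
    (mu : {measure set T -> \bar R}) (f : T -> R[i]) : R[i] :=
  (\int[mu]_x complex.Re (f x)) +i* (\int[mu]_x complex.Im (f x)).

Definition Cc (T : topologicalType) (f : T -> R[i]) :=
  continuous (f : T -> Ctop) /\ compact (closure [set x | f x != 0]).

Definition regular_borel (T : ptopologicalType)
    (mu : {measure set (borel T) -> \bar R}) :=
  [/\ forall K : set T, compact K -> (mu K < +oo)%E,
      forall A : set (borel T), measurable A ->
        mu A = ereal_inf [set mu U | U in [set U : set T | open U /\ A `<=` U]]
    & forall U : set T, open U ->
        mu U = ereal_sup [set mu K | K in [set K : set T | compact K /\ K `<=` U]]].

Definition left_haar (G : topGroupType)
    (mu : {measure set (borel G) -> \bar R}) :=
  [/\ regular_borel mu, mu setT != 0%E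
    & forall (x : G) (A : set (borel G)), measurable A ->
        mu [set (x * y)%g | y in A] = mu A].

Definition modular_function (G : topGroupType)
    (mu : {measure set (borel G) -> \bar R}) (Delta : G -> R) :=
  (forall x, 0 < Delta x) /\
  (forall f : G -> R[i], cintegrable mu f -> forall y : G,
    cintegral mu (fun x => f (x * y)%g) = (Delta (y^-1)%g)%:C * cintegral mu f).

Definition rho_function (G : topGroupType) (Gam : closedSubgroup G)
    (DeltaG : G -> R) (DeltaGam : csg_type Gam -> R) (rho : G -> R) :=
  [/\ continuous rho, forall x, 0 < rho x
    & forall (x : G) (xi : csg_type Gam),
        rho (x * val xi)%g = rho x * DeltaGam xi / DeltaG (val xi)].

(* The inner integral depends on the coset only, by left invariance of muGam:
   it can be computed with any representative. *)
Definition quotient_formula (G : topGroupType) (Gam : closedSubgroup G)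
    (muG : {measure set (borel G) -> \bar R})
    (muGam : {measure set (borel (csg_type Gam)) -> \bar R})
    (rho : G -> R)
    (muGGam : {measure set (borel (lcosets Gam)) -> \bar R}) :=
  forall f : G -> R[i], Cc f ->
    cintegral muG (fun x => f x * (rho x)%:C) =
    cintegral muGGam (fun q => cintegral muGam (fun xi => f (repr q * val xi)%g)).

End measures.

Section sections.
Variables (G : topGroupType) (Gam : closedSubgroup G).

Definition borel_section (tau : lcosets Gam -> G) :=
  [/\ measurable_fun setT (tau : borel (lcosets Gam) -> borel G),
      forall q, \pi_(lcosets Gam) (tau q) = q
    & forall K : set (lcosets Gam), compact K -> compact (closure (tau @` K))].

Definition right_section (tau : lcosets Gam -> G) (q : rcosets Gam) : G :=
  ((tau (eps q))^-1)%g.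

End sections.

(* As gamma (Gamma x) = tau (x^-1 Gamma)^-1 belongs to Gamma x, the orbit
   xi |-> xi * gamma (Gamma x) enumerates the coset Gamma x. *)
Definition right_quotient_formula (R : realType) (G : topGroupType)
    (Gam : closedSubgroup G)
    (muG : {measure set (borel G) -> \bar R})
    (muGam : {measure set (borel (csg_type Gam)) -> \bar R})
    (gamma : rcosets Gam -> G)
    (nu : {measure set (borel (rcosets Gam)) -> \bar R}) :=
  forall f : G -> R[i], cintegrable muG f ->
    cintegral muG f =
    cintegral nu (fun q => cintegral muGam (fun xi => f (val xi * gamma q)%g)).

(* Main.v *)
From HB Require Import structures.
Require Import Defs.
From mathcomp Require Import all_boot all_order all_algebra.
From mathcomp Require Import complex.
From mathcomp Require Import all_classical all_reals all_analysis.
From mathcomp Require Import measurable_realfun ring.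

(** Write [mu] for Haar measure on G, [tau] for the section of G/Gamma, and
    [gamma q] for the inverse of [tau (eps q)]. The measure on the space of
    right cosets is the image under [eps_inv] of the given measure on G/Gamma
    weighted by [1 / (rho (tau q) * DeltaG (tau q))]; the last formula of the
    theorem is then a change of variables, and the content of the theorem is
    the integration formula over G.

    That formula is obtained by inverting twice. The defining property of the
    measure on G/Gamma extends from [Cc] functions to all nonnegative Borel
    functions ([ge0_quotient_formula]): both sides are integrals against Borel
    measures on G, these agree on Urysohn functions, hence on open sets, hence
    everywhere. Next, a left Haar measure satisfies
    [\int F (x^-1) = \int F x * Delta (x^-1)] ([haar_inversion]); this follows
    from Tonelli's theorem applied to [F x * k (y * x)] for one test function
    [k]. For a Borel set [A], write [mu A] as an integral of [F (x^-1)] by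
    inversion on G, unfold it over G/Gamma, and invert the inner integral over
    Gamma: the rho function is exactly what makes the modular functions combine
    into a factor [DeltaGam (xi^-1)], absorbed by the inversion on Gamma, and
    the weight above ([weight_orbit], [haar_coset_formula]).

    In other words [mu] is the image of a product measure under
    [(q, xi) |-> xi * gamma q], and everything said about integrable functions
    on G is Fubini's theorem ([disintegration_integral] and its companions).

    The new measure is finite on compact sets because
    [nu K * muGam B <= mu C] when the compact set [C] contains all products
    [xi * gamma q] with [xi] in [B] and [q] in [K]. It inherits outer
    regularity from the measure on G/Gamma since the weight is bounded on
    compact sets, and inner regularity on open sets holds since these are
    countable increasing unions of compact sets. Uniqueness comes from testing
    the formula on the indicator of the box of those [xi * gamma q] with [q] in
    [A] and [xi] in [B]: for [A] inside a compact set its Haar measure is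
    [nu A * muGam B], which determines [nu A] ([right_box_value]). *)

Set Implicit Arguments.
Unset Strict Implicit.
Unset Printing Implicit Defensive.

Import Order.TTheory GRing.Theory Num.Theory.
Import numFieldNormedType.Exports.

Local Open Scope classical_set_scope.
Local Open Scope ring_scope.
Local Open Scope complex_scope.
Local Open Scope quotient_scope.

(** * Exhaustions and bump functions *)

(** Regularity is a local property, and compact Hausdorff spaces are regular. *)
Lemma locally_compact_regular (X : topologicalType) :
  hausdorff_space X -> locally_compact [set: X] -> @regular_space X.
Proof.
move=> hX lcX x.
have [U] := lcX x I; rewrite withinET => xU [cU _].
exact: compact_regular hX cU xU.
Qed.

(** By regularity, the members of a countable basis whose closure is compact and
    contained in [U] already cover [U]; the sets of the exhaustion are their
    finite unions. *)
Lemma open_exhaustion (X : ptopologicalType) (U : set X) :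
  hausdorff_space X -> @second_countable X -> locally_compact [set: X] ->
  open U ->
  exists V C : nat -> set X,
    [/\ forall n, open (V n), forall n, compact (C n),
        forall n, V n `<=` C n /\ C n `<=` U,
        (nondecreasing_seq V /\ nondecreasing_seq C)
      & \bigcup_n V n = U].
Proof.
move=> hX [B cB [Bo Bb]] lcX oU.
pose S := [set b | [/\ B b, compact (closure b) & closure b `<=` U]].
have cS : countable S by apply: sub_countable cB; apply: subset_card_le => b [].
have covS x : U x -> exists2 b, S b & b x.
  move=> Ux; have [K] := lcX x I; rewrite withinET => xK [cK clK].
  have xUK : nbhs x (U `&` K) by apply: filterI => //; exact: open_nbhs_nbhs.
  have [W xW WUK] := @locally_compact_regular _ hX lcX x _ xUK.
  have [b [Bbb bx] bW] := Bb x _ xW.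
  exists b => //; split => //.
    apply: subclosed_compact cK _; first exact: closed_closure.
    by apply: subset_trans (closureS bW) _ => y /WUK[].
  by apply: subset_trans (closureS bW) _ => y /WUK[].
(* The empty set pads the enumeration in case no basis element qualifies. *)
have [b Sb bS] : exists2 b : nat -> set X,
    forall n, b n = set0 \/ S (b n) & S `<=` range b.
  case/pfcard_geP: cS => [S0|[f]].
    by exists (fun=> set0) => [n|s]; [left|rewrite S0].
  exists f => [n|s Ss]; first by right; exact: funS.
  by have [n _ <-] := [elaborate @surj _ _ _ _ f s Ss]; exists n.
have bP n : [/\ open (b n), compact (closure (b n)) & closure (b n) `<=` U].
  case: (Sb n) => [->|[/Bo]//].
  by rewrite closure0; split => //; [exact: open0|exact: compact0].
exists (fun n => \big[setU/set0]_(i < n) b i),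
  (fun n => \big[setU/set0]_(i < n) closure (b i)); split.
- by move=> n /=; rewrite -bigcup_mkord; apply: bigcup_open => i _; case: (bP i).
- by move=> n; apply: bigsetU_compact => i _; case: (bP i).
- move=> n /=; split; last first.
    rewrite -(bigcup_mkord n (fun i => closure (b i))).
    by apply: bigcup_sub => i _; case: (bP i).
  rewrite -bigcup_mkord -(bigcup_mkord n (fun i => closure (b i))).
  apply: subset_bigcup => i _; exact: subset_closure.
- split; apply/nondecreasing_seqP => n; rewrite big_ord_recr /=;
    by apply/subsetPset; exact: subsetUl.
- rewrite eqEsubset; split.
    apply: bigcup_sub => n _ /=; rewrite -bigcup_mkord; apply: bigcup_sub => i _.
    by case: (bP i) => _ _; apply: subset_trans; exact: subset_closure.
  move=> x /covS[s /bS[n _ <-] bnx]; exists n.+1 => //=.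
  by rewrite -bigcup_mkord; exists n => /=.
Qed.

Lemma compact_sub_nondecreasing (X : ptopologicalType) (K : set X)
    (V : nat -> set X) :
  (forall n, open (V n)) -> nondecreasing_seq V -> compact K ->
  K `<=` \bigcup_n V n -> exists n, K `<=` V n.
Proof.
move=> oV ndV; rewrite compact_cover => /(_ _ setT V) H KV.
have [|//|D _ KD] := H _ _; first by move=> i _; exact: oV.
exists (\max_(i <- finmap.enum_fset D) i)%N => x /KD[i /= Di Vx].
have /ndV/subsetPset : (i <= \max_(i <- finmap.enum_fset D) i)%N.
  exact: leq_bigmax_seq.
exact.
Qed.

(** Urysohn's lemma needs a normal space: it is applied in the one-point
    compactification, to the image of [K] and to the complement of a relatively
    compact open neighbourhood of [K]. *)
Lemma bump_function (R : realType) (X : ptopologicalType) (K U : set X) :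
  hausdorff_space X -> @second_countable X -> locally_compact [set: X] ->
  compact K -> open U -> K `<=` U ->
  exists f : X -> R, [/\ continuous f, forall x, 0 <= f x <= 1,
    forall x, K x -> f x = 1,
    forall x, f x != 0 -> U x & compact (closure [set x | f x != 0])].
Proof.
move=> hX scX lcX cK oU KU.
have [V [C [oV cC VC [ndV _] VU]]] := open_exhaustion hX scX lcX oU.
have [n KVn] : exists n, K `<=` V n.
  by apply: compact_sub_nondecreasing => //; rewrite VU.
have hO := one_point_compactification_hausdorff lcX hX.
have nO : normal_space (one_point_compactification X).
  by apply: compact_normal => //; exact: one_point_compactification_compact.
pose S : X -> one_point_compactification X := Some.
have cS : continuous S by exact: one_point_compactification_some_continuous.
have clK : closed (S @` K).
  apply: compact_closed => //; apply: continuous_compact => //.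
  exact: continuous_subspaceT.
have clV : closed (~` (S @` V n)).
  apply: open_closedC.
  exact: one_point_compactification_open_some.
have KV0 : ~` (S @` V n) `&` S @` K = set0.
  apply/disjoints_subset; apply: subsetC => _ [x Kx <-]; exists x => //.
  exact: KVn.
have /(@uniform_separatorP _ R)[f [cf f01 f0 f1]] :=
  @normal_uniform_separator _ nO _ _ clV clK KV0.
have sub x : (f \o S) x != 0 -> V n x.
  move=> fx; apply: contrapT => nVx; move/eqP: fx; apply.
  by apply: f0; exists (S x) => //= -[y Vy [yx]]; rewrite -yx in nVx.
exists (f \o S); split.
- by move=> x; apply: continuous_comp; [exact: cS|exact: cf].
- by move=> x; have /f01 : range f (f (S x)) by []; rewrite /= in_itv.
- by move=> x Kx; apply: f1; exists (S x) => //; exists x.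
- by move=> x /sub; apply: (subset_trans (VC n).1 (VC n).2).
- apply: (subclosed_compact _ (cC n)); first exact: closed_closure.
  have /closure_id -> : closed (C n) by apply: compact_closed.
  by apply: closureS => x /sub; exact: (VC n).1.
Qed.

(** * Coset spaces, closed subgroups and Borel measurability *)

Lemma Cc_real (R : realType) (X : ptopologicalType) (f : X -> R) :
  continuous f -> compact (closure [set x | f x != 0]) ->
  Cc (fun x => (f x)%:C).
Proof.
move=> cf cptf; split; last first.
  suff -> : [set x | (f x)%:C != 0] = [set x | f x != 0] by [].
  by apply/seteqP; split => x /=; rewrite eq_complex /= eqxx andbT.
move=> x; apply/(@cvgrPdist_lt R[i] R[i]^o) => e e0.
have [re0 eE] : 0 < complex.Re e /\ e = (complex.Re e)%:C.
  by move: e0; case: e => a b; rewrite ltcE /= => /andP[/eqP -> ?].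
have /cvgrPdist_lt/(_ _ re0) := cf x; apply: filterS => y.
by rewrite eE -rmorphB /= normc_def /= expr0n addr0 sqrtr_sqr ltcR.
Qed.

Section coset_topology.
Variables (G : topGroupType) (Gam : closedSubgroup G).

Lemma mulgr_continuous (y : G) : continuous (fun x : G => (x * y)%g).
Proof.
move=> x; apply: (@continuous_comp _ _ _ (fun x : G => (x, y))
  (fun p : G * G => (p.1 * p.2)%g)); last exact: mulg_continuous.
by apply: cvg_pair; [exact: cvg_id|exact: cvg_cst].
Qed.

Lemma mulgl_continuous (x : G) : continuous (fun y : G => (x * y)%g).
Proof.
move=> y; apply: (@continuous_comp _ _ _ (fun y : G => (x, y))
  (fun p : G * G => (p.1 * p.2)%g)); last exact: mulg_continuous.
by apply: cvg_pair; [exact: cvg_cst|exact: cvg_id].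
Qed.

Lemma compact_mulg (A B : set G) : compact A -> compact B ->
  compact [set (x.1 * x.2)%g | x in A `*` B].
Proof.
move=> cA cB; apply: continuous_compact; last exact: compact_setX.
by apply: continuous_subspaceT; exact: mulg_continuous.
Qed.

Lemma compact_invg (A : set G) : compact A -> compact [set (x^-1)%g | x in A].
Proof.
by move=> cA; apply: continuous_compact => //; apply: continuous_subspaceT;
  exact: invg_continuous.
Qed.

(** The saturation of an open set is the union of its right translates by
    elements of the subgroup. *)
Lemma lcosets_pi_open (U : set G) : open U -> open (\pi_(lcosets Gam) @` U).
Proof.
move=> oU.
have -> : open (\pi_(lcosets Gam) @` U) =
  open (\pi_(lcosets Gam) @^-1` (\pi_(lcosets Gam) @` U)) by [].
have -> : \pi_(lcosets Gam) @^-1` (\pi_(lcosets Gam) @` U) =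
    \bigcup_(g in csg_set Gam) ((fun x : G => (x * g)%g) @^-1` U).
  apply/seteqP; split => x /=.
    move=> [u Uu /lcosetP/set_mem ux]; exists (x^-1 * u)%g; last first.
      by rewrite /= mulgA mulgV mul1g.
    by have /csgV := ux; rewrite invgM invgK.
  move=> [g Gg Ux]; exists (x * g)%g => //; apply/lcosetP/mem_set.
  by rewrite invgM mulgVK; exact: csgV.
apply: bigcup_open => g _; apply: open_comp => // x _.
exact: mulgr_continuous.
Qed.

(** If two cosets differ, then [x^-1 * y] lies in the open complement of the
    subgroup, and so does [a^-1 * b] for [a] near [x] and [b] near [y]. *)
Lemma lcosets_hausdorff : hausdorff_space (lcosets Gam).
Proof.
rewrite open_hausdorff => p q.
rewrite -[p]reprK -[q]reprK; set x := repr p; set y := repr q => /eqP xy.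
pose f (z : G * G) := ((z.1)^-1 * z.2)%g.
have cf : continuous f.
  move=> z; apply: (@continuous_comp _ _ _ (fun z : G * G => ((z.1)^-1, z.2)%g)
    (fun p : G * G => (p.1 * p.2)%g)); last exact: mulg_continuous.
  apply: cvg_pair; last exact: cvg_snd.
  by apply: continuous_comp; [exact: cvg_fst|exact: invg_continuous].
have : nbhs (x, y) (f @^-1` (~` Gam)).
  apply: cf; apply: open_nbhs_nbhs; split.
    by apply: closed_openC; exact: csg_closed.
  by move=> Gxy; apply: xy; apply/lcosetP/mem_set.
move=> [[A B] /= [xA yB] AB].
move: xA yB; rewrite !nbhsE => -[A' [oA' A'x] A'A] [B' [oB' B'y] B'B].
exists (\pi_(lcosets Gam) @` A', \pi_(lcosets Gam) @` B') => /=.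
  by split; apply/mem_set; [exists x|exists y].
split; [exact: lcosets_pi_open|exact: lcosets_pi_open|].
apply/eqP/seteqP; split => // _ [[a A'a <-] [b B'b /lcosetP/set_mem ba]].
apply: (AB (a, b)); first by split; [exact: A'A|exact: B'B].
by rewrite /f /=; have := csgV ba; rewrite invgM invgK.
Qed.

Lemma rcosets_hausdorff : hausdorff_space (rcosets Gam).
Proof.
move=> p q pq; rewrite -[p]epsK -[q]epsK; congr eps_inv.
apply: lcosets_hausdorff => A B pA qB.
have [r [Ar Br]] := pq (@eps G Gam @^-1` A) (@eps G Gam @^-1` B)
  (eps_continuous pA) (eps_continuous qB).
by exists (eps r).
Qed.

(** The inclusion of a closed subgroup is a closed embedding, hence proper. *)
Lemma csg_compact_preimage (C : set G) :
  compact C -> compact (val @^-1` C : set (csg_type Gam)).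
Proof.
move=> cC F PF FC.
have cCG : compact (C `&` Gam) by apply: compact_closedI => //; exact: csg_closed.
have [|x [[Cx Gx] clx]] := cCG (val @ F) _.
  have : F (val @^-1` (C `&` Gam)).
    by apply: filterS FC => y Cy; split => //; apply: set_mem; exact: (valP y).
  exact.
pose xi : csg_type Gam := Sub x (mem_set Gx).
exists xi; split => //.
move=> A B FA [B' [[W oW WB'] B'xi] B'B].
have FvA : (val @ F) [set val a | a in A].
  have : F (val @^-1` [set val a | a in A]).
    by apply: filterS FA => a Aa; exists a.
  exact.
have xW : nbhs x W.
  by apply: open_nbhs_nbhs; split => //; move: B'xi; rewrite -WB'.
have [y [[a Aa ay] Wy]] := clx _ _ FvA xW.
by exists a; split => //; apply: B'B; rewrite -WB' /=; rewrite -ay in Wy.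
Qed.

End coset_topology.

Lemma measurable_borel d (T : measurableType d) (X : ptopologicalType)
    (f : T -> X) :
  (forall U : set X, open U -> measurable (f @^-1` U)) ->
  measurable_fun setT (f : T -> borel X).
Proof.
move=> fU; apply: (@measurability _ _ _ (borel X) setT f (@open X)) => //.
by move=> _ [U oU <-]; rewrite setTI; exact: fU.
Qed.

Lemma borel_open (X : ptopologicalType) (U : set X) :
  open U -> measurable (U : set (borel X)).
Proof. exact: sub_sigma_algebra. Qed.

Lemma borel_closed (X : ptopologicalType) (U : set X) :
  closed U -> measurable (U : set (borel X)).
Proof.
move=> cU; rewrite -[U]setCK; apply: measurableC; apply: borel_open.
exact: closed_openC.
Qed.

Lemma continuous_borel (X Y : ptopologicalType) (f : X -> Y) :
  continuous f -> measurable_fun setT (f : borel X -> borel Y).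
Proof.
move=> cf; apply: measurable_borel => U oU; apply: borel_open.
by apply: open_comp => // x _; exact: cf.
Qed.

Lemma measurable_csg (G : topGroupType) (Gam : closedSubgroup G)
    d (T : measurableType d) (f : T -> csg_type Gam) :
  measurable_fun setT (val \o f : T -> borel G) ->
  measurable_fun setT (f : T -> borel (csg_type Gam)).
Proof.
move=> mf; apply: measurable_borel => U [W oW <-].
rewrite -[X in measurable X]setTI; apply: (mf _ W) => //.
exact: borel_open.
Qed.

(** Second countability makes every open subset of the product a countable
    union of open rectangles, so that the product sigma-algebra contains the
    Borel sets of the product topology. *)
Lemma measurable_mulg (G : topGroupType) : @second_countable G ->
  measurable_fun setT
    ((fun p => (p.1 * p.2)%g) : (borel G * borel G)%type -> borel G).
Proof.
move=> [B cB [Bo Bb]]; apply: measurable_borel => U oU.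
pose S := [set bc | [/\ B bc.1, B bc.2 &
  bc.1 `*` bc.2 `<=` (fun p : G * G => (p.1 * p.2)%g) @^-1` U]].
have -> : (fun p : G * G => (p.1 * p.2)%g) @^-1` U =
    \bigcup_(bc in S) (bc.1 `*` bc.2).
  apply/seteqP; split => [[x y] /= Uxy|]; last first.
    by move=> p [bc [_ _ bcU]]; exact: bcU.
  have : nbhs (x, y) ((fun p : G * G => (p.1 * p.2)%g) @^-1` U).
    by apply: mulg_continuous; exact: open_nbhs_nbhs.
  move=> [[A C] /= [xA yC] AC].
  have [b [Bb' bx] bA] := Bb x _ xA; have [c [Bc cy] cC] := Bb y _ yC.
  exists (b, c) => //; split => //= p [/bA p1 /cC p2]; exact: AC.
have mS bc : S bc -> measurable (bc.1 `*` bc.2 : set (borel G * borel G)%type).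
  by case: bc => b c [/Bo ob /Bo oc _]; apply: measurableX; exact: borel_open.
have : countable S.
  apply: (@sub_countable _ _ _ (B `*` B)); last exact: countableX.
  by apply: subset_card_le => -[b c] [].
case/pfcard_geP => [->|[f]]; first by rewrite bigcup_set0; exact: measurable0.
rewrite -(image_eq f) bigcup_image; apply: bigcupT_measurable => n.
by apply: mS; exact: funS.
Qed.

Lemma measurable_csg_mulg (G : topGroupType) (Gam : closedSubgroup G) :
  @second_countable G ->
  measurable_fun setT ((fun p => (p.1 * p.2)%g) :
    (borel (csg_type Gam) * borel (csg_type Gam))%type -> borel (csg_type Gam)).
Proof.
move=> scG; apply: measurable_csg.
have mval : measurable_fun setT (val : borel (csg_type Gam) -> borel G).
  by apply: continuous_borel; exact: csg_val_continuous.
pose vv (p : borel (csg_type Gam) * borel (csg_type Gam)) : borel G * borel G :=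
  (val p.1, val p.2).
have mvv : measurable_fun setT vv.
  apply: measurable_fun_pair.
    exact: (measurableT_comp mval measurable_fst).
  exact: (measurableT_comp mval measurable_snd).
exact: (measurableT_comp (measurable_mulg scG) mvv).
Qed.

(** * Measures with a density and image measures *)

Section density.
Local Open Scope ereal_scope.
Context d (T : measurableType d) (R : realType).
Variables (mu : {measure set T -> \bar R}) (h : T -> R).
Hypotheses (mh : measurable_fun setT h) (h0 : forall x, (0 <= h x)%R).

Let mEh : measurable_fun setT (EFin \o h).
Proof. exact/measurable_EFinP. Qed.

Lemma density_measure : exists nu : {measure set T -> \bar R},
  forall A, nu A = \int[mu]_(x in A) (h x)%:E.
Proof.
pose m (A : set T) := \int[mu]_(x in A) (h x)%:E.
have m0 : m set0 = 0 by rewrite /m integral_set0.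
have mge0 A : 0 <= m A by apply: integral_ge0 => x _; rewrite lee_fin.
have madd : semi_sigma_additive m.
  move=> A mA tA mUA; rewrite /m ge0_integral_bigcup//; last 2 first.
  - by apply: measurable_funTS; exact: mEh.
  - by move=> x _; rewrite lee_fin.
  by apply: is_cvg_ereal_nneg_natsum_cond => n _ _; exact: mge0.
pose mM := isMeasure.Build _ _ _ m m0 mge0 madd.
pose M : {measure set T -> \bar R} := HB.pack m mM.
by exists M.
Qed.

Variable nu : {measure set T -> \bar R}.
Hypothesis nuE : forall A, measurable A -> nu A = \int[mu]_(x in A) (h x)%:E.

Import HBNNSimple.

Let indic E : measurable E ->
  \int[nu]_x (\1_E x)%:E = \int[mu]_x ((\1_E x)%:E * (h x)%:E).
Proof.
move=> mE; rewrite integral_indic// setIT nuE// integral_mkcond.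
apply: eq_integral => x _; rewrite patchE indicE.
by case: ifP => _; rewrite ?mul1e ?mul0e.
Qed.

Let simple (f : {nnsfun T >-> R}) :
  \int[nu]_x (f x)%:E = \int[mu]_x ((f x)%:E * (h x)%:E).
Proof.
under [LHS]eq_integral do rewrite fimfunE -fsumEFin//.
rewrite [LHS]ge0_integral_fsum//; last 2 first.
  - by move=> r; exact/measurable_EFinP/measurableT_comp.
  - by move=> n x _; rewrite EFinM nnfun_muleindic_ge0.
under [RHS]eq_integral.
  move=> x xD; rewrite fimfunE -fsumEFin// muleC ge0_mule_fsumr; last first.
    by move=> r; rewrite EFinM nnfun_muleindic_ge0.
  over.
rewrite [RHS]ge0_integral_fsum//; last 2 first.
  - move=> r; apply: emeasurable_funM => //.
    by apply/measurable_EFinP; do 2 apply/measurableT_comp => //.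
  - move=> n x _; apply: mule_ge0; first by rewrite lee_fin.
    by rewrite EFinM nnfun_muleindic_ge0.
apply: eq_fsbigr => r _.
rewrite integralZl_indic_nnsfun// indic//.
have [r0|r0] := ltP r 0%R.
  rewrite preimage_nnfun0// !integral0_eq ?mule0// => x _.
    by rewrite indic0 mulr0 mule0.
  by rewrite indic0 mul0e.
rewrite -ge0_integralZl//; last 2 first.
  - apply: emeasurable_funM => //.
    by apply/measurable_EFinP; exact: measurable_indic.
  - by move=> x _; rewrite mule_ge0// lee_fin.
  - by apply: eq_integral => x _; rewrite EFinM [in RHS]muleC -muleA.
Qed.

(** By definition for indicators, then by linearity and monotone convergence. *)
Lemma ge0_integral_density (f : T -> \bar R) : measurable_fun setT f ->
  (forall x, 0 <= f x) -> \int[nu]_x f x = \int[mu]_x (f x * (h x)%:E).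
Proof.
move=> mf f0; pose f_ := nnsfun_approx measurableT mf.
have fE x : f x = limn (fun n => (f_ n x)%:E).
  by apply/esym/cvg_lim => //; exact: cvg_nnsfun_approx.
transitivity (limn (fun n => \int[nu]_x (f_ n x)%:E)).
  rewrite -monotone_convergence//=; first exact: eq_integral.
  - by move=> n; apply: measurableT_comp.
  - by move=> n x _; rewrite lee_fin.
  - by move=> x _ a b ab; rewrite lee_fin//; exact/lefP/nd_nnsfun_approx.
transitivity (limn (fun n => \int[mu]_x ((f_ n x)%:E * (h x)%:E))).
  by congr (limn _); apply/funext => n; exact: simple.
rewrite -monotone_convergence//=; last 3 first.
  - by move=> n; apply: emeasurable_funM => //; apply: measurableT_comp.
  - by move=> n x _; rewrite mule_ge0// lee_fin.
  - move=> x _ a b ab; apply: lee_wpmul2r; rewrite lee_fin//.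
    exact/lefP/nd_nnsfun_approx.
apply: eq_integral => x _; apply/cvg_lim => //.
by apply: cvgeZr => //; exact: cvg_nnsfun_approx.
Qed.

End density.

Lemma pushforward_measure (R : realType) d1 d2 (T1 : measurableType d1)
    (T2 : measurableType d2) (mu : {measure set T1 -> \bar R}) (phi : T1 -> T2) :
  measurable_fun setT phi ->
  exists nu : {measure set T2 -> \bar R}, forall A, nu A = mu (phi @^-1` A).
Proof.
move=> mphi.
pose nu : {measure set T2 -> \bar R} := pushforward mu phi.
by exists (nu mphi).
Qed.

Lemma measurable_funV (R : realType) d (T : measurableType d) (f : T -> R) :
  (forall x, 0 < f x) -> measurable_fun setT f ->
  measurable_fun setT (fun x => (f x)^-1).
Proof.
move=> f0 mf; under eq_fun do rewrite -powR_inv1 ?ltW//.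
exact: (measurableT_comp (measurable_powR _) mf).
Qed.

(** * Left Haar measures, modular functions and inversion *)

(** Change of variables, stated on the values of the two measures: with [c = 1]
    it covers image measures, with other constants translates of Haar
    measures. *)
Lemma ge0_integral_comp_scale (R : realType) d1 d2 (T1 : measurableType d1)
    (T2 : measurableType d2) (mu1 : {measure set T1 -> \bar R})
    (mu2 : {measure set T2 -> \bar R}) (phi : T1 -> T2) (c : R)
    (F : T2 -> \bar R) :
  0 <= c -> measurable_fun setT phi ->
  (forall A, measurable A -> mu1 (phi @^-1` A) = c%:E * mu2 A)%E ->
  measurable_fun setT F -> (forall y, 0 <= F y)%E ->
  (\int[mu1]_x F (phi x) = c%:E * \int[mu2]_y F y)%E.
Proof.
move=> c0 mphi E mF F0.
rewrite -(preimage_setT phi) -(ge0_integral_pushforward mphi)//.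
rewrite -[c]/((NngNum c0)%:num) -(ge0_integral_mscale mu2 measurableT)//.
by apply: eq_measure_integral => A mA _; exact: E.
Qed.

Lemma ge0_integrable (R : realType) d (T : measurableType d)
    (mu : {measure set T -> \bar R}) (f : T -> \bar R) :
  measurable_fun setT f -> (forall x, 0 <= f x)%E ->
  (\int[mu]_x f x < +oo)%E -> mu.-integrable setT f.
Proof.
move=> mf f0 foo; apply/integrableP; split => //.
by under eq_integral do rewrite gee0_abs//.
Qed.

Lemma cintegrable_real (R : realType) d (T : measurableType d)
    (mu : {measure set T -> \bar R}) (f : T -> R) :
  mu.-integrable setT (EFin \o f) -> cintegrable mu (fun x => (f x)%:C).
Proof. by move=> fi; split => //; exact: integrable0. Qed.

Lemma cintegral_real (R : realType) d (T : measurableType d)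
    (mu : {measure set T -> \bar R}) (f : T -> R) :
  cintegral mu (fun x => (f x)%:C) = (\int[mu]_x f x)%:C.
Proof. by rewrite /cintegral /= /Rintegral integral0. Qed.

Lemma integrable_indic_lty (R : realType) d (T : measurableType d)
    (mu : {measure set T -> \bar R}) (A : set T) :
  measurable A -> (mu A < +oo)%E -> mu.-integrable setT (EFin \o (\1_A : T -> R)).
Proof.
move=> mA Aoo; apply: ge0_integrable => [|x|].
- by apply/measurable_EFinP; exact: measurable_indic.
- by rewrite /= lee_fin.
- by rewrite integral_indic// setIT.
Qed.

Section left_haar_measure.
Local Open Scope ereal_scope.
Variables (R : realType) (H : topGroupType).
Variables (mu : {sigma_finite_measure set (borel H) -> \bar R}) (Delta : H -> R).
Hypothesis mulg_measurable : measurable_fun setT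
  ((fun p => (p.1 * p.2)%g) : (borel H * borel H)%type -> borel H).
Hypothesis haar : left_haar mu.
Hypothesis modular : modular_function mu Delta.

Let mmull (x : H) : measurable_fun setT ((fun y => (x * y)%g) : borel H -> borel H).
Proof. by apply: continuous_borel; exact: mulgl_continuous. Qed.

Let mmulr (y : H) : measurable_fun setT ((fun x => (x * y)%g) : borel H -> borel H).
Proof. by apply: continuous_borel; exact: mulgr_continuous. Qed.

Let minv : measurable_fun setT ((fun x => (x^-1)%g) : borel H -> borel H).
Proof. by apply: continuous_borel; exact: invg_continuous. Qed.

Let Delta_gt0 x : (0 < Delta x)%R. Proof. by case: modular. Qed.

Let measurable_preimage d1 d2 (T1 : measurableType d1) (T2 : measurableType d2)
    (f : T1 -> T2) A :
  measurable_fun setT f -> measurable A -> measurable (f @^-1` A).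
Proof. by move=> mf mA; rewrite -[X in measurable X]setTI; exact: mf. Qed.

Lemma haar_mull (x : H) (A : set (borel H)) : measurable A ->
  mu ((fun y : H => (x * y)%g) @^-1` A) = mu A.
Proof.
move=> mA; case: haar => _ _ /(_ (x^-1)%g A mA) <-; congr (mu _).
apply/seteqP; split => [y /= Ay|_ /= [y Ay <-]]; last by rewrite mulgA mulgV mul1g.
by exists (x * y)%g => //; rewrite mulgA mulVg mul1g.
Qed.

Lemma ge0_integral_mull (x : H) (F : borel H -> \bar R) :
  measurable_fun setT F -> (forall y, 0 <= F y) ->
  \int[mu]_y F (x * y)%g = \int[mu]_y F y.
Proof.
move=> mF F0; rewrite -[RHS]mul1e.
apply: (ge0_integral_comp_scale (T1 := borel H) (T2 := borel H)) => // A mA.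
by rewrite mul1e; exact: haar_mull.
Qed.

(** The modular function is defined through integrals of integrable functions;
    this is its action on arbitrary Borel sets. *)
Lemma haar_mulr (y : H) (A : set (borel H)) : measurable A ->
  mu ((fun x : H => (x * y)%g) @^-1` A) = (Delta (y^-1)%g)%:E * mu A.
Proof.
(* The modular identity concerns real integrals, which are 0 when the measure is
   infinite: it determines the measures only when both are finite. The sets [B n]
   below have this property and increase to [A]. *)
have fin (B : set (borel H)) : measurable B -> mu B < +oo ->
    mu ((fun x : H => (x * y)%g) @^-1` B) < +oo ->
    mu ((fun x : H => (x * y)%g) @^-1` B) = (Delta (y^-1)%g)%:E * mu B.
  move=> mB Boo yBoo.
  have mBr := measurable_preimage (mmulr y) mB.
  have iB : cintegrable mu (fun x : H => (\1_B x : R)%:C).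
    exact/cintegrable_real/integrable_indic_lty.
  have : cintegral mu (fun x : borel H => (\1_B (x * y)%g : R)%:C) =
      ((Delta (y^-1)%g)%:C * cintegral mu (fun x : borel H => (\1_B x : R)%:C))%R.
    exact: (modular.2 _ iB y).
  rewrite !cintegral_real -rmorphM /= => -[].
  rewrite /Rintegral !integral_indic// !setIT => e.
  rewrite -[LHS]fineK ?ge0_fin_numE//.
  by rewrite e EFinM fineK ?ge0_fin_numE.
move=> mA.
have /sigma_finiteP[F [FT ndF Foo]] := sigma_finiteT mu.
pose f (x : H) := (x * y)%g; pose g (x : H) := (x * y^-1)%g.
pose B n := A `&` (F n `&` g @^-1` F n).
have mF n : measurable (F n) by case: (Foo n).
have mB n : measurable (B n).
  by apply: measurableI => //; apply: measurableI => //;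
    exact: measurable_preimage (mmulr _) _.
have BA : \bigcup_n B n = A.
  rewrite -setI_bigcupr; apply/setIidPl => x _.
  have [i _ Fi] : (\bigcup_i F i) x by rewrite -FT.
  have [j _ Fj] : (\bigcup_i F i) (g x) by rewrite -FT.
  exists (maxn i j) => //; split.
    by have /subsetPset := ndF _ _ (leq_maxl i j); exact.
  by have /subsetPset := ndF _ _ (leq_maxr i j); exact.
have ndB : nondecreasing_seq B.
  move=> n m nm; apply/subsetPset => x [Ax [Fx Gx]].
  have /subsetPset FF := ndF _ _ nm.
  by split => //; split; exact: FF.
have cvB : mu \o B @ \oo --> mu A.
  by rewrite -BA; apply: nondecreasing_cvg_mu => //; rewrite BA.
have cvfB : (fun n => mu (f @^-1` B n)) @ \oo --> mu (f @^-1` A).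
  rewrite -BA preimage_bigcup; apply: nondecreasing_cvg_mu => //.
  - by move=> n; exact: measurable_preimage (mmulr _) _.
  - by rewrite -preimage_bigcup BA; exact: measurable_preimage (mmulr _) _.
  - move=> n m nm; apply/subsetPset; apply: preimage_subset.
    by apply/subsetPset; exact: ndB.
have fE : (fun n => mu (f @^-1` B n)) = (fun n => (Delta (y^-1)%g)%:E * mu (B n)).
  apply/funext => n; apply: fin => //.
    apply: le_lt_trans (Foo n).2; apply: le_measure; rewrite ?inE//.
    by move=> x [_ []].
  apply: le_lt_trans (Foo n).2; apply: le_measure; rewrite ?inE//.
    exact: measurable_preimage (mmulr _) _.
  by move=> x [_ [_]]; rewrite /g /f /= mulgK.
rewrite fE in cvfB.
have cvr : (fun n => (Delta (y^-1)%g)%:E * mu (B n)) @ \oo -->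
    (Delta (y^-1)%g)%:E * mu A by apply: cvgeZl.
exact: cvg_unique cvfB cvr.
Qed.

Lemma ge0_integral_mulr (y : H) (F : borel H -> \bar R) :
  measurable_fun setT F -> (forall x, 0 <= F x) ->
  \int[mu]_x F (x * y)%g = (Delta (y^-1)%g)%:E * \int[mu]_x F x.
Proof.
move=> mF F0; apply: ge0_integral_comp_scale => //; first exact: ltW.
by move=> A mA; exact: haar_mulr.
Qed.

(** The indicator of such a set is the test function by which values of the
    modular function and the inversion formula are computed. *)
Lemma haar_test_set : exists K : set (borel H),
  [/\ measurable K, 0 < mu K & mu K < +oo].
Proof.
have /sigma_finiteP[F [FT ndF Foo]] := sigma_finiteT mu.
have [[n Fn]|] := pselect (exists n, 0 < mu (F n)).
  by exists (F n); split => //; case: (Foo n).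
move=> noF; case: haar => _ /eqP + _; case.
rewrite FT.
have : mu \o F @ \oo --> mu (\bigcup_n F n).
  apply: nondecreasing_cvg_mu => //; first by move=> n; case: (Foo n).
  by apply: bigcup_measurable => n _; case: (Foo n).
have -> : mu \o F = fun=> 0.
  apply/funext => n /=; apply/eqP; rewrite eq_le measure_ge0 andbT leNgt.
  by apply/negP => Fn; apply: noF; exists n.
by move=> /cvg_unique; apply => //; exact: cvg_cst.
Qed.

(** [Delta y] is the quotient of the measures of a translate of [K] and of [K],
    and the measure of a translate is a section integral. *)
Lemma modular_measurable : measurable_fun setT (Delta : borel H -> R).
Proof.
have [K [mK K0 Koo]] := haar_test_set.
have Kfin : (0 < fine (mu K))%R by rewrite fine_gt0// K0.
have DE (y : H) : Delta y =
    (fine (mu (ysection ((fun p : borel H * borel H => (p.1 * p.2)%g) @^-1` K)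
      (y^-1)%g)) / fine (mu K))%R.
  have -> : ysection ((fun p : borel H * borel H => (p.1 * p.2)%g) @^-1` K)
      (y^-1)%g = (fun x : H => (x * y^-1)%g) @^-1` K.
    by apply/seteqP; split => x; rewrite ysectionE.
  rewrite haar_mulr// invgK fineM//=; last by rewrite ge0_fin_numE.
  by rewrite mulfK ?gt_eqF.
rewrite (funext DE); apply: measurable_funM => //.
have mF : measurable_fun setT (fun y : borel H => mu (ysection
    ((fun p : borel H * borel H => (p.1 * p.2)%g) @^-1` K) y)).
  apply: (measurable_fun_ysection mu); exact: measurable_preimage mulg_measurable mK.
apply: (measurableT_comp (f := fine)); first exact: fine_measurable.
exact: (measurableT_comp mF minv).
Qed.

Lemma modularM (x y : H) : Delta (x * y)%g = (Delta x * Delta y)%R.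
Proof.
have [K [mK K0 Koo]] := haar_test_set.
have Kfin : (0 < fine (mu K))%R by rewrite fine_gt0// K0.
have E z : mu ((fun x : H => (x * z^-1)%g) @^-1` K) = (Delta z)%:E * mu K.
  by rewrite haar_mulr// invgK.
have mE z : measurable ((fun x : borel H => (x * z^-1)%g : borel H) @^-1` K).
  exact: measurable_preimage (mmulr _) _.
have : (Delta (x * y)%g)%:E * mu K = (Delta y)%:E * ((Delta x)%:E * mu K).
  rewrite -!E -[in RHS](invgK y) -haar_mulr//; congr (mu _).
  by apply/seteqP; split => z /=; rewrite invgM mulgA.
rewrite -(fineK (x := mu K)) ?ge0_fin_numE// -!EFinM => -[].
by rewrite mulrA [(Delta y * _)%R]mulrC => /mulIf; apply; rewrite gt_eqF.
Qed.

Lemma modular1 : Delta 1%g = 1%R.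
Proof.
have := modularM 1%g 1%g; rewrite mulg1 -[LHS]mulr1 => /mulfI -> //.
by rewrite gt_eqF.
Qed.

Lemma modularV (x : H) : Delta (x^-1)%g = ((Delta x)^-1)%R.
Proof.
apply: (@mulfI _ (Delta x)); first by rewrite gt_eqF.
by rewrite -modularM mulgV modular1 divff// gt_eqF.
Qed.

(** The double integral of [F x * k (y * x)] is computed in both orders. Over
    [y] first, right translation produces [Delta (x^-1)]. Over [x] first, left
    translation turns the integrand into [F (y^-1 * x) * k x], whose integral
    over [y] is that of [F (y^-1)] by left invariance. Both results carry the
    finite positive factor [mu K]. *)
Lemma haar_inversion (F : borel H -> \bar R) :
  measurable_fun setT F -> (forall x, 0 <= F x) ->
  \int[mu]_x F (x^-1)%g = \int[mu]_x (F x * (Delta (x^-1)%g)%:E).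
Proof.
move=> mF F0; have [K [mK K0 Koo]] := haar_test_set.
pose k (x : borel H) : \bar R := (\1_K x)%:E.
have mk : measurable_fun setT k.
  by apply/measurable_EFinP; exact: measurable_indic.
have k0 x : 0 <= k x by rewrite lee_fin.
have Ik : \int[mu]_x k x = mu K by rewrite integral_indic// setIT.
pose mulH (p : borel H * borel H) : borel H := (p.1 * p.2)%g.
have mswap : measurable_fun setT (fun p : borel H * borel H => mulH (p.2, p.1)).
  apply: (measurableT_comp (f := mulH)) => //.
  exact: measurable_fun_pair measurable_snd measurable_fst.
have mdiv : measurable_fun setT
    (fun p : borel H * borel H => mulH ((p.2^-1)%g, p.1)).
  apply: (measurableT_comp (f := mulH)) => //.
  apply: measurable_fun_pair measurable_fst.
  exact: (measurableT_comp minv measurable_snd).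
have mFD : measurable_fun setT (fun x : borel H => F x * (Delta (x^-1)%g)%:E).
  apply: emeasurable_funM => //; apply/measurable_EFinP.
  exact: (measurableT_comp modular_measurable minv).
have FD0 (x : H) : 0 <= F x * (Delta (x^-1)%g)%:E.
  by rewrite mule_ge0// lee_fin ltW.
have mFV : measurable_fun setT (fun x : borel H => F (x^-1)%g).
  exact: (measurableT_comp mF minv).
suff : mu K * \int[mu]_x F (x^-1)%g =
       mu K * \int[mu]_x (F x * (Delta (x^-1)%g)%:E).
  move=> e; apply/eqP; rewrite eq_le -(lee_pmul2l (x := mu K)) ?ge0_fin_numE//.
  by rewrite -[X in _ && X](lee_pmul2l (x := mu K)) ?ge0_fin_numE// e lexx.
transitivity (\int[mu]_x \int[mu]_y (F x * k (y * x)%g)); last first.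
  rewrite -ge0_integralZl//; apply: eq_integral => x _.
  rewrite ge0_integralZl//; last first.
    exact: (measurableT_comp mk (mmulr x)).
  by rewrite ge0_integral_mulr// Ik muleA muleC.
rewrite (fubini_tonelli (fun p : borel H * borel H => F p.1 * k (p.2 * p.1)%g));
  last 2 first.
- apply: emeasurable_funM.
    exact: (measurableT_comp mF measurable_fst).
  exact: (measurableT_comp mk mswap).
- by move=> p; rewrite mule_ge0.
transitivity (\int[mu]_y \int[mu]_x (F (y^-1 * x)%g * k x)); last first.
  apply: eq_integral => y _.
  rewrite -(ge0_integral_mull y (F := fun x => F (y^-1 * x)%g * k x)).
  - by apply: eq_integral => x _ /=; rewrite mulgA mulVg mul1g.
  - apply: emeasurable_funM => //; exact: (measurableT_comp mF (mmull _)).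
  - by move=> x; rewrite mule_ge0.
rewrite -(fubini_tonelli (fun p : borel H * borel H =>
  F (p.2^-1 * p.1)%g * k p.1)); last 2 first.
- apply: emeasurable_funM; first exact: (measurableT_comp mF mdiv).
  exact: (measurableT_comp mk measurable_fst).
- by move=> p; rewrite mule_ge0.
rewrite -Ik -ge0_integralZr//; last exact: integral_ge0.
apply: eq_integral => x _.
rewrite /= ge0_integralZr//; last first.
  exact: (measurableT_comp mF (measurableT_comp (mmulr x) minv)).
rewrite muleC; congr (_ * _).
rewrite -(ge0_integral_mull (x^-1)%g (F := fun y => F (y^-1)%g))//.
by apply: eq_integral => y _; rewrite invgM invgK.
Qed.

End left_haar_measure.

(** * Borel measures on second countable locally compact spaces *)

Lemma continuous_real_borel (R : realType) (X : ptopologicalType) (f : X -> R) :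
  continuous f -> measurable_fun setT (f : borel X -> R).
Proof.
move=> cf; apply: (@measurability _ _ (borel X) _ setT f _ (RGenOInfty.measurableE R)).
move=> _ [_ [x ->] <-]; rewrite setTI; apply: borel_open.
apply: open_comp; first by move=> y _; exact: cf.
exact: interval_open.
Qed.

Lemma continuous_injective_hausdorff (X Y : topologicalType) (f : X -> Y) :
  continuous f -> injective f -> hausdorff_space Y -> hausdorff_space X.
Proof.
move=> cf fI hY p q pq; apply: fI; apply: hY => A B pA qB.
have [r [Ar Br]] := pq (f @^-1` A) (f @^-1` B) (cf _ _ pA) (cf _ _ qB).
by exists (f r).
Qed.

Lemma csg_hausdorff (G : topGroupType) (Gam : closedSubgroup G) :
  hausdorff_space G -> hausdorff_space (csg_type Gam).
Proof.
apply: continuous_injective_hausdorff; last exact: val_inj.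
exact: csg_val_continuous.
Qed.

Lemma compact_ubound (R : realType) (X : topologicalType) (K : set X) (f : X -> R) :
  continuous f -> compact K -> exists2 M : R, 0 <= M & forall x, K x -> f x <= M.
Proof.
move=> cf cK.
have /compact_bounded[M [_ /(_ (`|M| + 1))]] : compact (f @` K).
  by apply: continuous_compact => //; exact: continuous_subspaceT.
have MM : M < `|M| + 1 by rewrite (le_lt_trans (ler_norm M))// ltrDl.
move=> /(_ MM) b; exists (`|M| + 1); first by rewrite addr_ge0.
by move=> x Kx; rewrite (le_trans (ler_norm _))// b//; exists x.
Qed.

Lemma borel_compact (X : ptopologicalType) (K : set X) :
  hausdorff_space X -> compact K -> measurable (K : set (borel X)).
Proof. by move=> hX cK; apply: borel_closed; exact: compact_closed. Qed.

Lemma sigma_finite_exhaustion (R : realType) (X : ptopologicalType)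
    (mu : {measure set (borel X) -> \bar R}) (C : nat -> set X) :
  hausdorff_space X -> (forall K : set X, compact K -> (mu K < +oo)%E) ->
  (forall n, compact (C n)) -> \bigcup_n C n = setT -> sigma_finite setT mu.
Proof.
move=> hX muK cC CT; exists C => // n; split; last exact: muK.
exact: borel_compact.
Qed.

(** Each member [V n] of the exhaustion of [U] is separated from the complement
    of [U] by a bump function, which gives [m1 (V n) <= m2 U]. *)
Lemma borel_measure_le_open (R : realType) (X : ptopologicalType)
    (m1 m2 : {measure set (borel X) -> \bar R}) (U : set X) :
  hausdorff_space X -> @second_countable X -> locally_compact [set: X] ->
  (forall f : X -> R, continuous f -> (forall x, 0 <= f x <= 1) ->
     compact (closure [set x | f x != 0]) ->
     (\int[m1]_x (f x)%:E <= \int[m2]_x (f x)%:E)%E) ->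
  open U -> (m1 U <= m2 U)%E.
Proof.
move=> hX scX lcX m12 oU.
have [V [C [oV cC VC [ndV _] VU]]] := open_exhaustion hX scX lcX oU.
have cvgV : m1 \o V @ \oo --> m1 U.
  rewrite -VU; apply: (@nondecreasing_cvg_mu _ (borel X)) => //.
    by move=> n; exact: borel_open.
  by rewrite VU; exact: borel_open.
rewrite -(cvg_lim _ cvgV)//; apply: lime_le; first by apply/cvg_ex; exists (m1 U).
apply: nearW => n /=.
have [f [cf f01 f1 fU cptf]] := bump_function R hX scX lcX (cC n) oU (VC n).2.
have mf : measurable_fun setT (EFin \o (f : borel X -> R)).
  by apply/measurable_EFinP; exact: continuous_real_borel cf.
have f0 x : 0 <= f x by case/andP: (f01 x).
have mV : measurable (V n : set (borel X)) by exact: borel_open.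
have mU : measurable (U : set (borel X)) by exact: borel_open.
apply: (@le_trans _ _ (\int[m1]_x (f x)%:E)%E).
  rewrite -[X in (m1 X <= _)%E]setIT -(integral_indic m1 measurableT)//.
  apply: ge0_le_integral => //.
  - by apply/measurable_EFinP; exact: measurable_indic.
  - move=> x _; rewrite lee_fin indicE; case: (boolP (x \in V n)) => //.
    by move=> /set_mem/(VC n).1/f1 ->.
apply: (le_trans (m12 f cf f01 cptf)).
rewrite -[X in (_ <= m2 X)%E]setIT -(integral_indic m2 measurableT)//.
apply: ge0_le_integral => //.
- by move=> x _; rewrite lee_fin.
- by apply/measurable_EFinP; exact: measurable_indic.
- move=> x _; rewrite lee_fin indicE; case: (boolP (x \in U)) => xU.
    by case/andP: (f01 x).
  rewrite leNgt; apply/negP => fx; case/negP: xU; apply/mem_set/fU.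
  by rewrite gt_eqF.
Qed.

(** Open sets are stable under intersection and generate the Borel sets, and an
    exhaustion provides a countable cover of finite measure. *)
Lemma borel_measure_eq (R : realType) (X : ptopologicalType)
    (m1 m2 : {measure set (borel X) -> \bar R}) :
  hausdorff_space X -> @second_countable X -> locally_compact [set: X] ->
  (forall K : set X, compact K -> (m1 K < +oo)%E) ->
  (forall f : X -> R, continuous f -> (forall x, 0 <= f x <= 1) ->
     compact (closure [set x | f x != 0]) ->
     (\int[m1]_x (f x)%:E = \int[m2]_x (f x)%:E)%E) ->
  forall A : set (borel X), measurable A -> m1 A = m2 A.
Proof.
move=> hX scX lcX m1K m12 A mA.
have [V [C [oV cC VC _ VT]]] := open_exhaustion hX scX lcX (@openT X).
apply: (@measure_unique _ R (borel X) (@open X) V) => //.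
- exact: openI.
- move=> U oU; apply/eqP; rewrite eq_le !borel_measure_le_open//.
    by move=> f cf f01 cptf; rewrite m12.
  by move=> f cf f01 cptf; rewrite m12.
- move=> n; apply: le_lt_trans (m1K _ (cC n)); apply: le_measure.
  + by rewrite inE; exact: borel_open.
  + by rewrite inE; exact: borel_compact.
  + exact: (VC n).1.
Qed.

(** * Haar measures on compact sets and outer regularity *)

(** By inner regularity of the whole space. *)
Lemma haar_compact_gt0 (R : realType) (H : topGroupType)
    (mu : {measure set (borel H) -> \bar R}) :
  left_haar mu -> exists2 K : set H, compact K & (0 < mu K)%E.
Proof.
move=> [[_ _ inner] mu0 _].
have : (0 < mu setT)%E by rewrite lt0e mu0 measure_ge0.
by rewrite (inner _ openT) => /ereal_sup_gt[_ [K [cK _] <-] K0]; exists K.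
Qed.

(** For [x] in [T], [Delta (x^-1)] is the quotient by [mu K] of the measure of
    the translate of [K] by [x^-1], which stays in the compact set formed by
    the products of [K] with the inverses of [T]. *)
Lemma modular_inv_locally_bounded (R : realType) (H : topGroupType)
    (mu : {sigma_finite_measure set (borel H) -> \bar R}) (Delta : H -> R)
    (T : set H) :
  hausdorff_space H -> left_haar mu -> modular_function mu Delta ->
  compact T -> exists2 M : R, 0 <= M & forall x, T x -> (Delta x)^-1 <= M.
Proof.
move=> hH haar modular cT; have [K cK K0] := haar_compact_gt0 haar.
have muoo (C : set H) : compact C -> (mu C < +oo)%E by case: haar => -[+ _ _] _ _; exact.
have mK : measurable (K : set (borel H)) by exact: borel_compact.
pose C := [set (x.1 * x.2)%g | x in K `*` [set (x^-1)%g | x in T]].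
have cC : compact C by apply: compact_mulg => //; exact: compact_invg.
have Kfin : 0 < fine (mu K) by rewrite fine_gt0// K0 muoo.
exists (fine (mu C) / fine (mu K)); first by rewrite divr_ge0// fine_ge0.
move=> x Tx; rewrite ler_pdivlMr// -(modularV haar modular).
rewrite -lee_fin EFinM !fineK ?ge0_fin_numE ?muoo//.
rewrite -(haar_mulr modular)//; apply: le_measure; rewrite ?inE.
- rewrite -[X in measurable X]setTI.
  by apply: continuous_borel => //; exact: mulgr_continuous.
- exact: borel_compact.
- move=> z Kz; exists (z * x, x^-1)%g => /=; last by rewrite mulgK.
  by split => //; exists x.
Qed.

(** Outer regularity may be checked locally: the errors on the pieces are made
    summable. *)
Lemma outer_regular_exhaustion (R : realType) (X : ptopologicalType)
    (nu : {measure set (borel X) -> \bar R}) (V : nat -> set X) :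
  (forall n, open (V n)) -> \bigcup_n V n = setT ->
  (forall n (A : set (borel X)), measurable A -> A `<=` V n ->
    forall e : R, 0 < e ->
    exists U : set X, [/\ open U, A `<=` U & (nu (U `\` A) <= e%:E)%E]) ->
  forall A : set (borel X), measurable A ->
    nu A = ereal_inf [set nu U | U in [set U : set X | open U /\ A `<=` U]].
Proof.
move=> oV VT approx A mA; apply/eqP; rewrite eq_le; apply/andP; split.
  apply: le_ereal_inf_tmp => _ [U [oU AU] <-]; apply: le_measure; rewrite ?inE//.
  exact: borel_open.
apply/lee_addgt0Pr => e e0.
pose d n := e / (2 ^ n.+1)%:R.
have d0 n : 0 < d n by rewrite divr_gt0// ltr0n expn_gt0.
have mV n : measurable (V n : set (borel X)) by exact: borel_open.
have mAV n : measurable (A `&` V n) by exact: measurableI.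
have [U UP] := choice (fun n => approx n _ (mAV n) (@subIsetr _ _ _) _ (d0 n)).
have mU n : measurable (U n : set (borel X)).
  by case: (UP n) => oU _ _; exact: borel_open.
have oUU : open (\bigcup_n U n) by apply: bigcup_open => n _; case: (UP n).
have mUU : measurable (\bigcup_n U n : set (borel X)) by exact: borel_open.
have AU : A `<=` \bigcup_n U n.
  move=> x Ax; have [n _ Vx] : (\bigcup_n V n) x by rewrite VT.
  by exists n => //; case: (UP n) => _ + _; apply.
apply: (@le_trans _ _ (nu (\bigcup_n U n))).
  by apply: ereal_inf_lbound; exists (\bigcup_n U n).
rewrite (measureDI nu mUU mA) addeC; apply: leeD.
  by apply: le_measure; rewrite ?inE//; exact: measurableI.
apply: (@le_trans _ _ (\sum_(n <oo) nu (U n `\` (A `&` V n)))%E).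
  apply: measure_sigma_subadditive.
  - by move=> n; exact: measurableD.
  - exact: measurableD.
  - move=> x [[n _ Ux] nAx]; exists n => //; split => // -[].
    by move=> /nAx.
apply: (@le_trans _ _ (\sum_(n <oo) (d n)%:E)%E).
  by apply: lee_nneseries => // n _; case: (UP n).
exact: (epsilon_trick0 xpredT (ltW e0)).
Qed.

(** * Change of variables and disintegration of integrable functions *)

(** Positive and negative parts commute with composition and with
    multiplication by a nonnegative weight. *)
Lemma integral_transfer (R : realType) d1 d2 (X : measurableType d1)
    (Y : measurableType d2) (nu : {measure set X -> \bar R})
    (mu : {measure set Y -> \bar R}) (phi : Y -> X) (w : Y -> R) (f : X -> R) :
  measurable_fun setT phi -> measurable_fun setT w -> (forall y, 0 <= w y) ->
  (forall g : X -> \bar R, measurable_fun setT g -> (forall x, 0 <= g x)%E ->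
    (\int[nu]_x g x = \int[mu]_y (g (phi y) * (w y)%:E))%E) ->
  nu.-integrable setT (EFin \o f) ->
  mu.-integrable setT (EFin \o (fun y => f (phi y) * w y)) /\
  (\int[nu]_x (f x)%:E = \int[mu]_y (f (phi y) * w y)%:E)%E.
Proof.
move=> mphi mw w0 nuE fi.
have mEf : measurable_fun setT (EFin \o f) by exact: measurable_int fi.
have mf : measurable_fun setT f by apply/measurable_EFinP.
have mfw : measurable_fun setT (fun y => f (phi y) * w y).
  by apply: measurable_funM => //; exact: (measurableT_comp mf mphi).
split.
  apply/integrableP; split; first exact/measurable_EFinP.
  have mabs : measurable_fun setT (abse \o (EFin \o f)) by exact: measurableT_comp.
  case/integrableP: fi => _; rewrite (nuE _ mabs (fun x => abse_ge0 _)).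
  congr (_ < _)%E; apply: eq_integral => y _ /=.
  by rewrite normrM (ger0_norm (w0 y)) EFinM.
rewrite [LHS]integralE [RHS]integralE; congr (_ - _)%E.
  rewrite nuE//; last exact: measurable_funepos.
  apply: eq_integral => y _; rewrite !funeposE /= -!EFin_max -EFinM.
  by rewrite maxr_pMl// mul0r.
rewrite nuE//; last exact: measurable_funeneg.
apply: eq_integral => y _; rewrite !funenegE /= -!EFin_max -EFinM.
by rewrite maxr_pMl// mul0r mulNr.
Qed.

(** Fubini's theorem for a measure that is the image of a product measure. The
    inner integral [F] is real valued, with a default value at the points where
    the section of [f] is not integrable. *)
Section disintegration.
Context (R : realType) d d1 d2 (T : measurableType d) (T1 : measurableType d1)
  (T2 : measurableType d2).
Variables (mu : {measure set T -> \bar R})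
  (m1 : {sigma_finite_measure set T1 -> \bar R})
  (m2 : {sigma_finite_measure set T2 -> \bar R}) (Phi : T1 * T2 -> T).
Hypotheses (mPhi : measurable_fun setT Phi)
  (muE : forall A, measurable A -> mu A = (m1 \x m2)%E (Phi @^-1` A)).
Variable f : T -> R.
Hypothesis fi : mu.-integrable setT (EFin \o f).

Let g (p : T1 * T2) : \bar R := (f (Phi p))%:E.
Let F x := \int[m2]_y f (Phi (x, y)).

Let mf : measurable_fun setT f.
Proof. by apply/measurable_EFinP; exact: measurable_int fi. Qed.

Let product_transfer : (m1 \x m2)%E.-integrable setT g /\
  (\int[mu]_x (f x)%:E = \int[(m1 \x m2)%E]_p g p)%E.
Proof.
have gE : g = EFin \o (fun p => f (Phi p) * cst 1 p).
  by apply/funext => p; rewrite /= mulr1.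
rewrite gE; apply: integral_transfer => // h mh h0.
under [RHS]eq_integral do rewrite mule1.
rewrite -[LHS]mul1e.
rewrite -(ge0_integral_comp_scale (mu1 := (m1 \x m2)%E) ler01 mPhi)//.
by move=> A mA; rewrite mul1e muE.
Qed.

Let gi : (m1 \x m2)%E.-integrable setT g. Proof. by case: product_transfer. Qed.

Lemma disintegration_ae :
  {ae m1, forall x, m2.-integrable setT (fun y => (f (Phi (x, y)))%:E)}.
Proof. exact: ae_integrable1 gi. Qed.

Lemma disintegration_measurable : measurable_fun setT F.
Proof.
apply: (measurableT_comp (f := fine)); first exact: fine_measurable.
exact: measurable_fubini_F gi.
Qed.

Lemma disintegration_integrable : m1.-integrable setT (EFin \o F).
Proof.
apply: le_integrable (integrable_fubini_F gi) => //.
  by apply/measurable_EFinP; exact: disintegration_measurable.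
move=> x _ /=; rewrite /fubini_F /F /Rintegral; case: (integral _ _ _) => //=.
  by rewrite normr0 leey.
by rewrite normr0 leey.
Qed.

(** The partial integral of Fubini's theorem is extended real valued; it
    coincides with [F] where the section is integrable, hence almost
    everywhere. *)
Lemma disintegration_integral : \int[mu]_x f x = \int[m1]_x F x.
Proof.
rewrite /Rintegral product_transfer.2 -(integral12_prod_meas1 gi); congr fine.
apply: ae_eq_integral => //.
- exact: measurable_fubini_F gi.
- by apply/measurable_EFinP; exact: disintegration_measurable.
- apply: filterS disintegration_ae => x xi _.
  by rewrite /F /fubini_F /= fineK//; exact: integrable_fin_num xi.
Qed.

End disintegration.

(** * Integration over G through the coset spaces *)

Section coset_integration.
Local Open Scope ereal_scope.
Variables (R : realType) (G : topGroupType) (Gam : closedSubgroup G).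
Variables (muG : {sigma_finite_measure set (borel G) -> \bar R})
  (muGam : {sigma_finite_measure set (borel (csg_type Gam)) -> \bar R})
  (muGGam : {sigma_finite_measure set (borel (lcosets Gam)) -> \bar R})
  (DeltaG : G -> R) (DeltaGam : csg_type Gam -> R) (rho : G -> R)
  (tau : lcosets Gam -> G).
Hypotheses (hausdorffG : hausdorff_space G)
  (second_countableG : @second_countable G)
  (locally_compactG : locally_compact [set: G])
  (haarG : left_haar muG) (haarGam : left_haar muGam)
  (modularG : modular_function muG DeltaG)
  (modularGam : modular_function muGam DeltaGam)
  (rhoP : rho_function DeltaG DeltaGam rho)
  (muGGam_regular : regular_borel muGGam)
  (muGGamP : quotient_formula muG muGam rho muGGam)
  (tauP : borel_section tau).

Let mval : measurable_fun setT (val : borel (csg_type Gam) -> borel G).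
Proof. by apply: continuous_borel; exact: csg_val_continuous. Qed.

Let mtau : measurable_fun setT (tau : borel (lcosets Gam) -> borel G).
Proof. by case: tauP. Qed.

Let rho_gt0 x : (0 < rho x)%R. Proof. by case: rhoP. Qed.

Let mrho : measurable_fun setT (rho : borel G -> R).
Proof. by apply: continuous_real_borel; case: rhoP. Qed.

Definition orbit (p : borel (lcosets Gam) * borel (csg_type Gam)) : borel G :=
  (tau p.1 * val p.2)%g.

Lemma measurable_orbit : measurable_fun setT orbit.
Proof.
pose tv (p : borel (lcosets Gam) * borel (csg_type Gam)) : borel G * borel G :=
  (tau p.1, val p.2).
have mtv : measurable_fun setT tv.
  apply: measurable_fun_pair.
    exact: (measurableT_comp mtau measurable_fst).
  exact: (measurableT_comp mval measurable_snd).
exact: (measurableT_comp (measurable_mulg second_countableG) mtv).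
Qed.

(** If [tau q * xi] lies in [S], then [xi] lies in the product of the inverse of
    the relatively compact set [tau @` K] with [S]. *)
Lemma orbit_compact (K : set (lcosets Gam)) (S : set G) :
  compact K -> compact S -> exists2 D : set (csg_type Gam), compact D &
    forall q xi, K q -> S (tau q * val xi)%g -> D xi.
Proof.
move=> cK cS; have cT : compact (closure (tau @` K)) by case: tauP => _ _; exact.
exists (val @^-1` [set (x.1 * x.2)%g | x in
    [set (x^-1)%g | x in closure (tau @` K)] `*` S]).
  by apply: csg_compact_preimage; apply: compact_mulg => //; exact: compact_invg.
move=> q xi Kq Sq; exists ((tau q)^-1, tau q * val xi)%g => /=.
  split => //; exists (tau q) => //; apply: subset_closure; by exists q.
by rewrite mulgA mulVg mul1g.
Qed.

(** By left invariance on the subgroup, the integral over a coset can be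
    computed from any representative. *)
Lemma integral_orbit_repr (f : G -> R) (q : lcosets Gam) :
  continuous f -> (forall x, 0 <= f x)%R ->
  \int[muGam]_xi (f (repr q * val xi)%g)%:E =
  \int[muGam]_xi (f (tau q * val xi)%g)%:E.
Proof.
move=> cf f0.
have /lcosetP rt : \pi_(lcosets Gam) (repr q) = \pi_(lcosets Gam) (tau q).
  by case: tauP => _ -> _; rewrite reprK.
(* [tau q = repr q * xi0], and the integral is invariant under translation by
   [xi0]. *)
pose xi0 : csg_type Gam := exist _ ((repr q)^-1 * tau q)%g rt.
pose F (xi : borel (csg_type Gam)) : \bar R := (f (repr q * val xi)%g)%:E.
have mF : measurable_fun setT F.
  apply/measurable_EFinP; apply: continuous_real_borel => xi.
  apply: (@continuous_comp _ _ _ (fun xi : csg_type Gam => (repr q * val xi)%g) f).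
    apply: (@continuous_comp (csg_type Gam) G G (val : csg_type Gam -> G)
      (fun x : G => (repr q * x)%g)).
      exact: csg_val_continuous.
    exact: mulgl_continuous.
  exact: cf.
have F0 xi : 0 <= F xi by rewrite lee_fin.
have := ge0_integral_mull haarGam xi0 mF F0; rewrite /F => <-.
apply: eq_integral => xi _; congr (f _)%:E.
have -> : val (xi0 * xi)%g = ((repr q)^-1 * tau q * val xi)%g by [].
by rewrite !mulgA mulgV mul1g.
Qed.

(** The hypothesis is an equality of real integrals, in which an infinite
    integral counts as 0; it only becomes an equality of extended real
    integrals once all of them are known to be finite. They are dominated by
    multiples of the indicators of [S], of its image [K] and of [D]. *)
Lemma quotient_formula_bump (f : G -> R) :
  continuous f -> (forall x, 0 <= f x <= 1)%R ->
  compact (closure [set x | f x != 0%R]) ->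
  \int[muG]_x (f x * rho x)%:E =
  \int[muGGam]_q \int[muGam]_xi (f (tau q * val xi)%g)%:E.
Proof.
move=> cf f01 cS; set S := closure _ in cS.
have f0 x : (0 <= f x)%R by case/andP: (f01 x).
have fS x : (f x <= \1_S x)%R.
  rewrite indicE; case: (boolP (x \in S)) => xS; first by case/andP: (f01 x).
  rewrite leNgt; apply/negP => fx; case/negP: xS; apply/mem_set.
  by apply: subset_closure; rewrite /= gt_eqF.
have mf : measurable_fun setT (f : borel G -> R) by exact: continuous_real_borel.
pose K := \pi_(lcosets Gam) @` S.
have cK : compact K.
  apply: continuous_compact => //; apply: continuous_subspaceT.
  exact: pi_continuous.
have mK : measurable (K : set (borel (lcosets Gam))).
  by apply: borel_compact => //; exact: lcosets_hausdorff.
have mS : measurable (S : set (borel G)) by exact: borel_compact.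
have [D cD DP] := orbit_compact cK cS.
have mD : measurable (D : set (borel (csg_type Gam))).
  by apply: borel_compact => //; exact: csg_hausdorff.
have Koo : muGGam K < +oo by case: muGGam_regular => + _ _; exact.
have Doo : muGam D < +oo by case: haarGam => -[+ _ _] _ _; exact.
have Soo : muG S < +oo by case: haarG => -[+ _ _] _ _; exact.
pose I q := \int[muGam]_xi (f (tau q * val xi)%g)%:E.
have mforb : measurable_fun setT (fun p => (f (orbit p))%:E).
  apply/measurable_EFinP; exact: (measurableT_comp mf measurable_orbit).
have I0 q : 0 <= I q by apply: integral_ge0 => xi _; rewrite lee_fin.
have mI : measurable_fun setT (I : borel (lcosets Gam) -> \bar R).
  apply: (measurable_fun_fubini_tonelli_F (fun p => (f (orbit p))%:E)) => //.
  by move=> p; rewrite lee_fin.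
have mfq q : measurable_fun setT
    (fun xi : borel (csg_type Gam) => (f (tau q * val xi)%g)%:E).
  exact: (measurable_fun_pair2 (q : borel (lcosets Gam)) mforb).
have Ile q : I q <= (\1_K q)%:E * muGam D.
  rewrite indicE; case: (boolP (q \in K)) => [/set_mem|] Kq.
    rewrite mul1e -[D in leRHS]setIT -(integral_indic muGam measurableT)//.
    apply: ge0_le_integral => //.
    - by move=> xi _; rewrite lee_fin.
    - by apply/measurable_EFinP; exact: measurable_indic.
    - move=> xi _; rewrite lee_fin; apply: (le_trans (fS _)); rewrite !indicE.
      case: (boolP (_ \in S)) => [/set_mem xS|_]; last by rewrite ler0n.
      by rewrite mem_set//; exact: DP xS.
  rewrite mul0e /I integral0_eq// => xi _; congr EFin.
  apply/eqP; rewrite eq_le f0 andbT; apply: (le_trans (fS _)).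
  rewrite indicE; case: (boolP (_ \in S)) => // /set_mem xS.
  case/negP: Kq; apply/mem_set; exists (tau q * val xi)%g => //.
  case: tauP => _ /(_ q) {2}<- _; apply/lcosetP; rewrite invgM mulgVK.
  by apply/mem_set/csgV/set_mem; exact: (valP xi).
have Iint : \int[muGGam]_q I q < +oo.
  apply: (@le_lt_trans _ _ (muGGam K * muGam D)); last first.
    by rewrite lte_mul_pinfty// ge0_fin_numE.
  apply: (@le_trans _ _ (\int[muGGam]_q ((\1_K q)%:E * muGam D))).
    apply: ge0_le_integral => //.
    - by apply: emeasurable_funM => //; apply/measurable_EFinP; exact: measurable_indic.
  rewrite ge0_integralZr//.
  - by rewrite integral_indic// setIT.
  - by apply/measurable_EFinP; exact: measurable_indic.
have [M M0 rhoM] : exists2 M : R, (0 <= M)%R & forall x, S x -> (rho x <= M)%R.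
  by apply: compact_ubound => //; case: rhoP.
have mfrho : measurable_fun setT (fun x : borel G => (f x * rho x)%:E).
  by apply/measurable_EFinP; exact: measurable_funM.
have frho0 x : 0 <= (f x * rho x)%:E by rewrite lee_fin mulr_ge0// ltW.
have Gint : \int[muG]_x (f x * rho x)%:E < +oo.
  apply: (@le_lt_trans _ _ (M%:E * muG S)); last first.
    by rewrite lte_mul_pinfty// lee_fin.
  rewrite -[S in leRHS]setIT -(integral_indic muG measurableT)//.
  rewrite -ge0_integralZl//; last first.
    by apply/measurable_EFinP; exact: measurable_indic.
  apply: ge0_le_integral => //.
  - apply: emeasurable_funM => //.
    by apply/measurable_EFinP; exact: measurable_indic.
  - move=> x _; rewrite -EFinM lee_fin mulrC.
    case: (boolP (x \in S)) => [/set_mem Sx|xS].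
      by apply: ler_pM => //; [exact: ltW|exact: rhoM].
    have -> : f x = 0%R.
      apply/eqP; rewrite eq_le f0 andbT; apply: (le_trans (fS x)).
      by rewrite indicE (negbTE xS).
    by rewrite mulr0 mulr_ge0.
have := muGGamP (Cc_real cf cS).
have -> : (fun x => (f x)%:C * (rho x)%:C)%R = (fun x : G => (f x * rho x)%:C)%R.
  by apply/funext => x; rewrite rmorphM.
rewrite (@cintegral_real _ _ (borel G)).
under [X in cintegral _ X]eq_fun do
  rewrite (@cintegral_real _ _ (borel (csg_type Gam)) muGam).
rewrite (@cintegral_real _ _ (borel (lcosets Gam))) => -[].
rewrite /Rintegral.
under [X in _ = fine X]eq_integral do rewrite integral_orbit_repr//.
move=> e; rewrite -[LHS]fineK ?ge0_fin_numE//; last exact: integral_ge0.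
have Ifin : \int[muGGam]_q I q \is a fin_num.
  by rewrite ge0_fin_numE//; apply: integral_ge0.
rewrite e -[RHS](fineK Ifin).
congr (fine _)%:E; apply: eq_integral => q _; rewrite fineK//.
rewrite ge0_fin_numE; last exact: I0.
apply: (le_lt_trans (Ile q)); rewrite indicE; case: (_ \in _).
  by rewrite mul1e.
by rewrite mul0e.
Qed.

(** The left side is the integral of [u] against the measure of density [rho],
    the right side its integral against the image of the product measure under
    [orbit]; these two Borel measures agree on bump functions. *)
Lemma ge0_quotient_formula (u : G -> \bar R) :
  measurable_fun setT (u : borel G -> \bar R) -> (forall x, 0 <= u x) ->
  \int[muG]_x (u x * (rho x)%:E) =
  \int[muGGam]_q \int[muGam]_xi u (tau q * val xi)%g.
Proof.
move=> um u0.
have rho0 x : (0 <= rho x)%R by rewrite ltW.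
have [m1 m1E] := density_measure muG mrho rho0.
have [m2 m2E] := pushforward_measure (muGGam \x muGam) measurable_orbit.

have orbE (v : G -> \bar R) : measurable_fun setT (v : borel G -> \bar R) ->
    (forall x, 0 <= v x) ->
    \int[m2]_x v x = \int[muGGam]_q \int[muGam]_xi v (tau q * val xi)%g.
  move=> mv v0; rewrite -[LHS]mul1e.
  rewrite -(ge0_integral_comp_scale (mu1 := muGGam \x muGam) ler01
    measurable_orbit) => [||//|//]; last by move=> A _; rewrite mul1e m2E.
  rewrite fubini_tonelli1//; exact: (measurableT_comp mv measurable_orbit).
have rhoE (v : G -> \bar R) : measurable_fun setT (v : borel G -> \bar R) ->
    (forall x, 0 <= v x) -> \int[m1]_x v x = \int[muG]_x (v x * (rho x)%:E).
  by move=> mv v0; exact: ge0_integral_density mrho rho0 _ (fun A _ => m1E A) _ mv v0.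
rewrite -rhoE// -orbE//; apply: eq_measure_integral => A mA _.
apply: borel_measure_eq => // [K cK|f cf f01 cptf].
  have [M M0 rhoM] := compact_ubound (let: And3 c _ _ := rhoP in c) cK.
  have mK : measurable (K : set (borel G)) by exact: borel_compact.
  rewrite m1E; apply: (@le_lt_trans _ _ (\int[muG]_(x in K) M%:E)).
    apply: ge0_le_integral => //.
    - by move=> x _; rewrite lee_fin.
    - by apply/measurable_EFinP; exact: measurable_funTS.
  rewrite integral_cst// lte_mul_pinfty//.
  by case: haarG => -[+ _ _] _ _; exact.
have mf : measurable_fun setT (EFin \o (f : borel G -> R)).
  by apply/measurable_EFinP; exact: continuous_real_borel.
have f0 x : 0 <= (f x)%:E by rewrite lee_fin; case/andP: (f01 x).
rewrite (rhoE (EFin \o f))// (orbE (EFin \o f))//.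
by rewrite -quotient_formula_bump.
Qed.

Definition coset_weight (q : lcosets Gam) : R := (rho (tau q) * DeltaG (tau q))^-1.

Let DeltaG_gt0 x : (0 < DeltaG x)%R. Proof. by case: modularG. Qed.
Let DeltaGam_gt0 x : (0 < DeltaGam x)%R. Proof. by case: modularGam. Qed.

Let mmulG := measurable_mulg second_countableG.
Let mmulGam := measurable_csg_mulg (Gam := Gam) second_countableG.

Let mDeltaG : measurable_fun setT (DeltaG : borel G -> R).
Proof. exact: (modular_measurable mmulG haarG modularG). Qed.

Let mDeltaGam : measurable_fun setT (DeltaGam : borel (csg_type Gam) -> R).
Proof. exact: (modular_measurable mmulGam haarGam modularGam). Qed.

Let minvG : measurable_fun setT ((fun x => (x^-1)%g) : borel G -> borel G).
Proof. by apply: continuous_borel; exact: invg_continuous. Qed.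

Lemma coset_weight_gt0 q : (0 < coset_weight q)%R.
Proof. by rewrite invr_gt0 mulr_gt0. Qed.

Lemma measurable_coset_weight :
  measurable_fun setT (coset_weight : borel (lcosets Gam) -> R).
Proof.
have mrD : measurable_fun setT (fun x : borel G => (rho x * DeltaG x)%R).
  exact: measurable_funM.
apply: measurable_funV; first by move=> q; rewrite mulr_gt0.
exact: (measurableT_comp mrD mtau).
Qed.

(** The covariance of [rho] cancels the value of [DeltaG] on the subgroup. *)
Lemma weight_orbit (q : lcosets Gam) (xi : csg_type Gam) :
  (DeltaG ((tau q * val xi)^-1)%g / rho (tau q * val xi)%g =
   coset_weight q * DeltaGam (xi^-1)%g)%R.
Proof.
have -> : rho (tau q * val xi)%g = (rho (tau q) * DeltaGam xi / DeltaG (val xi))%R.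
  by case: rhoP.
rewrite (modularV haarG modularG) (modularM haarG modularG).
rewrite (modularV haarGam modularGam) /coset_weight.
have := rho_gt0 (tau q); have := DeltaG_gt0 (tau q); have := DeltaG_gt0 (val xi).
have := DeltaGam_gt0 xi.
by move=> d0 c0 b0 a0; field; rewrite !gt_eqF.
Qed.

(** [muG A] is the integral of [F (x^-1)] for [F = \1_A * DeltaG], by inversion
    on G. Unfolding it over G/Gamma and inverting the inner integral over Gamma
    for [F' xi = \1_A (xi * (tau q)^-1) * DeltaGam xi] gives the formula. *)
Lemma haar_coset_formula (A : set (borel G)) : measurable A ->
  muG A = \int[muGGam]_q (muGam [set xi | A (val xi * (tau q)^-1)%g] *
                          (coset_weight q)%:E).
Proof.
move=> mA.
have mind : measurable_fun setT (EFin \o (\1_A : borel G -> R)).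
  by apply/measurable_EFinP; exact: measurable_indic.
pose F (x : borel G) : \bar R := (\1_A x * DeltaG x)%:E.
have mF : measurable_fun setT F.
  by apply/measurable_EFinP; apply: measurable_funM => //; exact: measurable_indic.
have F0 x : 0 <= F x by rewrite lee_fin mulr_ge0// ltW.
have -> : muG A = \int[muG]_x F (x^-1)%g.
  rewrite (haar_inversion mmulG haarG modularG)//.
  under eq_integral => x _.
    rewrite -EFinM -mulrA -(modularM haarG modularG) mulgV.
    rewrite (modular1 haarG modularG) mulr1.
  over.
  by rewrite integral_indic// setIT.
pose u (x : borel G) : \bar R := F (x^-1)%g * ((rho x)^-1)%:E.
have um : measurable_fun setT u.
  apply: emeasurable_funM; first exact: (measurableT_comp mF minvG).
  by apply/measurable_EFinP; exact: measurable_funV.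
have u0 x : 0 <= u x by rewrite mule_ge0// lee_fin invr_ge0 ltW.
transitivity (\int[muG]_x (u x * (rho x)%:E)).
  apply: eq_integral => x _; rewrite /u -muleA -EFinM mulVf ?gt_eqF//.
  by rewrite mulr1.
rewrite ge0_quotient_formula//; apply: eq_integral => q _.
pose F' (xi : borel (csg_type Gam)) : \bar R :=
  (\1_A (val xi * (tau q)^-1)%g * DeltaGam xi)%:E.
have mr : measurable_fun setT ((fun x => (x * (tau q)^-1)%g) : borel G -> borel G).
  by apply: continuous_borel; exact: mulgr_continuous.
have mAq : measurable ([set xi | A (val xi * (tau q)^-1)%g]
    : set (borel (csg_type Gam))).
  by rewrite -[X in measurable X]setTI; exact: (measurableT_comp mr mval).
have mindq : measurable_fun setT
    (fun xi : borel (csg_type Gam) => (\1_A (val xi * (tau q)^-1)%g : R)).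
  exact: (measurableT_comp (measurable_indic mA) (measurableT_comp mr mval)).
have mF' : measurable_fun setT F'.
  by apply/measurable_EFinP; exact: measurable_funM.
have F'0 x : 0 <= F' x by rewrite lee_fin mulr_ge0// ltW.
transitivity (\int[muGam]_xi (F' (xi^-1)%g * (coset_weight q)%:E)).
  apply: eq_integral => xi _; rewrite /u /F /F' -!EFinM; congr EFin.
  have -> : val (xi^-1)%g = ((val xi)^-1)%g by [].
  by rewrite -mulrA weight_orbit invgM -mulrA [(coset_weight q * _)%R]mulrC.
rewrite ge0_integralZr//; last 2 first.
- apply: (measurableT_comp mF').
  by apply: continuous_borel; exact: invg_continuous.
- by rewrite lee_fin ltW// coset_weight_gt0.
congr (_ * _); rewrite (haar_inversion mmulGam haarGam modularGam)//.
under eq_integral => xi _.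
  rewrite -EFinM -mulrA -(modularM haarGam modularGam) mulgV.
  rewrite (modular1 haarGam modularGam) mulr1.
over.
by rewrite -[X in muGam X]setIT -(integral_indic muGam measurableT).
Qed.

(** * The measure on the space of right cosets *)

Let mtauV : measurable_fun setT
  ((fun q => (tau q)^-1)%g : borel (lcosets Gam) -> borel G).
Proof.
exact: (measurableT_comp minvG mtau).
Qed.

Let mepsV : measurable_fun setT
  (@eps_inv G Gam : borel (lcosets Gam) -> borel (rcosets Gam)).
Proof. by apply: continuous_borel; exact: eps_inv_continuous. Qed.

Lemma right_measure_exists :
  exists nu : {measure set (borel (rcosets Gam)) -> \bar R},
  forall g : borel (rcosets Gam) -> \bar R,
    measurable_fun setT g -> (forall q, 0 <= g q) ->
    \int[nu]_q g q = \int[muGGam]_q (g (eps_inv q) * (coset_weight q)%:E).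
Proof.
have w0 q : (0 <= coset_weight q)%R by rewrite ltW// coset_weight_gt0.
have [m mE] := density_measure muGGam measurable_coset_weight w0.
have [nu nuE] := pushforward_measure m mepsV.
exists nu => g mg g0; rewrite -[LHS]mul1e.
rewrite -(ge0_integral_comp_scale (mu1 := m) ler01 mepsV)//; last first.
  by move=> A _; rewrite mul1e nuE.
rewrite (ge0_integral_density measurable_coset_weight w0 (fun A _ => mE A))//.
exact: (measurableT_comp mg mepsV).
Qed.

Local Notation gamma := (right_section tau).

Lemma right_section_pi q : \pi_(rcosets Gam) (gamma q) = q.
Proof.
rewrite -[RHS](epsK q); case: tauP => _ /(_ (eps q)) tauK _.
by rewrite -[in RHS]tauK eps_inv_pi.
Qed.

Lemma right_orbit_pi q (xi : csg_type Gam) :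
  \pi_(rcosets Gam) (val xi * gamma q)%g = q.
Proof.
rewrite -[RHS]right_section_pi; apply/rcosetP.
by rewrite mulgK; exact: (valP xi).
Qed.

Lemma measurable_right_section :
  measurable_fun setT (gamma : borel (rcosets Gam) -> borel G).
Proof.
exact: (measurableT_comp mtauV (continuous_borel (@eps_continuous G Gam))).
Qed.

Definition right_orbit (p : borel (rcosets Gam) * borel (csg_type Gam)) :
  borel G := (val p.2 * gamma p.1)%g.

Lemma measurable_right_orbit : measurable_fun setT right_orbit.
Proof.
pose tv (p : borel (rcosets Gam) * borel (csg_type Gam)) : borel G * borel G :=
  (val p.2, gamma p.1).
have mtv : measurable_fun setT tv.
  apply: measurable_fun_pair.
    exact: (measurableT_comp mval measurable_snd).
  exact: (measurableT_comp measurable_right_section measurable_fst).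
exact: (measurableT_comp (measurable_mulg second_countableG) mtv).
Qed.

Lemma right_orbit_compact (K : set (rcosets Gam)) (B : set (csg_type Gam)) :
  compact K -> compact B -> exists2 C : set G, compact C &
    forall q xi, K q -> B xi -> C (val xi * gamma q)%g.
Proof.
move=> cK cB.
have ceK : compact (@eps G Gam @` K).
  by apply: continuous_compact => //; apply: continuous_subspaceT;
    exact: eps_continuous.
have cT : compact (closure (tau @` (@eps G Gam @` K))).
  by case: tauP => _ _; exact.
exists [set (x.1 * x.2)%g | x in (val @` B) `*`
    [set (x^-1)%g | x in closure (tau @` (@eps G Gam @` K))]].
  apply: compact_mulg; last exact: compact_invg.
  apply: continuous_compact => //; apply: continuous_subspaceT.
  exact: csg_val_continuous.
move=> q xi Kq Bxi; exists (val xi, gamma q) => //=; split; first by exists xi.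
exists (tau (eps q)) => //; apply: subset_closure; by exists (eps q).
Qed.

Lemma rcosets_pi_open (U : set G) : open U -> open (\pi_(rcosets Gam) @` U).
Proof.
move=> oU; have -> : \pi_(rcosets Gam) @` U = @eps G Gam @^-1`
    (\pi_(lcosets Gam) @` ((fun x : G => (x^-1)%g) @^-1` U)).
  apply/seteqP; split => [_ [x Ux <-]|q [x Ux xq]] /=.
    by exists (x^-1)%g; rewrite /= ?invgK// eps_pi.
  by exists (x^-1)%g => //; rewrite -(epsK q) -xq eps_inv_pi.
apply: open_comp => [x _|]; first exact: eps_continuous.
apply: lcosets_pi_open; apply: open_comp => // x _; exact: invg_continuous.
Qed.

Lemma rcosets_open_exhaustion (U : set (rcosets Gam)) : open U ->
  exists V C : nat -> set (rcosets Gam),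
    [/\ forall n, open (V n), forall n, compact (C n),
        forall n, V n `<=` C n /\ C n `<=` U,
        (nondecreasing_seq V /\ nondecreasing_seq C)
      & \bigcup_n V n = U].
Proof.
move=> oU; pose W := \pi_(rcosets Gam) @^-1` U.
have oW : open W by apply: open_comp => // x _; exact: pi_continuous.
have [V [C [oV cC VC [ndV ndC] VW]]] :=
  open_exhaustion hausdorffG second_countableG locally_compactG oW.
exists (fun n => \pi_(rcosets Gam) @` V n), (fun n => \pi_(rcosets Gam) @` C n).
split.
- by move=> n; exact: rcosets_pi_open.
- move=> n; apply: continuous_compact => //; apply: continuous_subspaceT.
  exact: pi_continuous.
- move=> n; split; first by apply: image_subset; exact: (VC n).1.
  by move=> _ [x Cx <-]; exact: (VC n).2.
- split=> n m nm; apply/subsetPset; apply: image_subset; apply/subsetPset.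
    exact: ndV.
  exact: ndC.
- rewrite -image_bigcup VW; apply/seteqP; split => [_ [x Wx <-]//|q Uq].
  by exists (repr q); rewrite /W /= reprK.
Qed.

Section right_measure.
Variable nu : {measure set (borel (rcosets Gam)) -> \bar R}.
Hypothesis nuE : forall g : borel (rcosets Gam) -> \bar R,
  measurable_fun setT g -> (forall q, 0 <= g q) ->
  \int[nu]_q g q = \int[muGGam]_q (g (eps_inv q) * (coset_weight q)%:E).

Lemma haar_right_formula (A : set (borel G)) : measurable A ->
  muG A = \int[nu]_q muGam [set xi | A (val xi * gamma q)%g].
Proof.
move=> mA; rewrite haar_coset_formula// nuE//; last first.
  have mP : measurable (right_orbit @^-1` A).
    by rewrite -[X in measurable X]setTI; exact: measurable_right_orbit.
  have := measurable_fun_xsection muGam mP; congr (measurable_fun _ _).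
  apply/funext => q /=; congr (muGam _).
  by apply/seteqP; split => xi; rewrite xsectionE.
apply: eq_integral => q _; congr (muGam _ * _); apply/funext => xi.
by rewrite /= /right_section eps_invK.
Qed.

(** A compact [B] of positive measure in the subgroup bounds [nu K * muGam B] by
    the Haar measure of a compact set. *)
Lemma right_measure_compact (K : set (rcosets Gam)) : compact K -> nu K < +oo.
Proof.
move=> cK; have [B cB B0] := haar_compact_gt0 haarGam.
have [C cC CP] := right_orbit_compact cK cB.
have mC : measurable (C : set (borel G)) by exact: borel_compact.
have mB : measurable (B : set (borel (csg_type Gam))).
  by apply: borel_compact => //; exact: csg_hausdorff.
have mK : measurable (K : set (borel (rcosets Gam))).
  by apply: borel_compact => //; exact: rcosets_hausdorff.
have Boo : muGam B < +oo by case: haarGam => -[+ _ _] _ _; exact.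
have mCs q : measurable ([set xi | C (val xi * gamma q)%g]
    : set (borel (csg_type Gam))).
  rewrite -[X in measurable X]setTI.
  exact: (measurable_fun_pair2 (q : borel (rcosets Gam)) measurable_right_orbit).
have : nu K * muGam B <= muG C.
  rewrite haar_right_formula// -[X in nu X]setIT -(integral_indic nu measurableT)//.
  rewrite -ge0_integralZr//; last first.
    by apply/measurable_EFinP; exact: measurable_indic.
  apply: ge0_le_integral => //.
  - by move=> q _; rewrite mule_ge0// lee_fin.
  - apply: emeasurable_funM => //.
    by apply/measurable_EFinP; exact: measurable_indic.
  - have mP : measurable (right_orbit @^-1` C).
      by rewrite -[X in measurable X]setTI; exact: measurable_right_orbit.
    have := measurable_fun_xsection muGam mP; congr (measurable_fun _ _).
    apply/funext => q /=; congr (muGam _).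
    by apply/seteqP; split => xi; rewrite xsectionE.
  - move=> q _; rewrite indicE; case: (boolP (q \in K)) => [/set_mem Kq|_].
      rewrite mul1e; apply: le_measure; rewrite ?inE// => xi Bxi.
      exact: CP.
    by rewrite mul0e.
have Coo : muG C < +oo by case: haarG => -[+ _ _] _ _; exact.
move=> /le_lt_trans /(_ Coo); rewrite !ltey; apply: contraNN => /eqP ->.
by rewrite gt0_mulye.
Qed.

Lemma right_measure_sigma_finite : sigma_finite setT nu.
Proof.
have [V [C [_ cC VC _ VT]]] := rcosets_open_exhaustion openT.
apply: (sigma_finite_exhaustion (@rcosets_hausdorff G Gam) _ cC).
  exact: right_measure_compact.
by apply/seteqP; split => // q _; move: (I : setT q); rewrite -VT => -[n _ Vq];
  exists n => //; exact: (VC n).1.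
Qed.

(** * Regularity *)

Lemma weight_bounded (K : set (lcosets Gam)) : compact K ->
  exists2 M : R, (0 <= M)%R & forall q, K q -> (coset_weight q <= M)%R.
Proof.
move=> cK; have cT : compact (closure (tau @` K)) by case: tauP => _ _; exact.
have crho : continuous (fun x : G => (rho x)^-1%R).
  move=> x; apply: cvgV; first by rewrite gt_eqF.
  by case: rhoP => + _ _; exact.
have [M1 M10 M1P] := compact_ubound crho cT.
have [M2 M20 M2P] := modular_inv_locally_bounded hausdorffG haarG modularG cT.
exists (M1 * M2)%R => [|q Kq]; first exact: mulr_ge0.
have Tq : closure (tau @` K) (tau q) by apply: subset_closure; exists q.
rewrite /coset_weight invfM; apply: ler_pM.
- by rewrite invr_ge0 ltW.
- by rewrite invr_ge0 ltW//; case: modularG.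
- exact: M1P.
- exact: M2P.
Qed.

(** An open set approximating the image of [A] in G/Gamma up to [e / (M + 1)]
    approximates [A] up to [e], where [M] bounds the weight on the image of
    [K]. *)
Lemma right_measure_outer_regular (V K : set (rcosets Gam))
    (A : set (borel (rcosets Gam))) (e : R) :
  open V -> compact K -> V `<=` K -> measurable A -> A `<=` V -> (0 < e)%R ->
  exists U : set (rcosets Gam),
    [/\ open U, A `<=` U & nu (U `\` A) <= e%:E].
Proof.
move=> oV cK VK mA AV e0.
have cK' : compact (@eps G Gam @` K).
  by apply: continuous_compact => //; apply: continuous_subspaceT;
    exact: eps_continuous.
have [M M0 MP] := weight_bounded cK'.
pose A' : set (borel (lcosets Gam)) := @eps_inv G Gam @^-1` A.
have mA' : measurable A' by rewrite -[X in measurable X]setTI; exact: mepsV.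
have A'K : A' `<=` @eps G Gam @` K.
  by move=> q A'q; exists (eps_inv q); [exact/VK/AV|exact: eps_invK].
have [cptoo outer _] := muGGam_regular.
have A'oo : muGGam A' < +oo.
  apply: le_lt_trans (cptoo _ cK'); apply: le_measure; rewrite ?inE//.
  by apply: borel_compact => //; exact: lcosets_hausdorff.
have A'fin : muGGam A' \is a fin_num by rewrite ge0_fin_numE.
(* [M + 1] rather than [M], which may be 0. *)
pose d := (e / (M + 1))%R.
have M1 : (0 < M + 1)%R by rewrite ltr_wpDl.
have d0 : (0 < d)%R by rewrite divr_gt0.
have inffin : ereal_inf [set muGGam U | U in
    [set U : set (lcosets Gam) | open U /\ A' `<=` U]] \is a fin_num.
  by rewrite -outer.
have [_ [U' [oU' A'U'] <-]] := lb_ereal_inf_adherent d0 inffin.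
rewrite -outer// => U'lt.
have mU' : measurable (U' : set (borel (lcosets Gam))) by exact: borel_open.
have U'A' : muGGam (U' `\` A') <= d%:E.
  move: U'lt; rewrite (measureDI muGGam mU' mA').
  have -> : U' `&` A' = A' by apply/setIidPr.
  by rewrite addeC lteD2lE// => /ltW.
pose U := V `&` @eps G Gam @^-1` U'.
have oU : open U.
  apply: openI => //; apply: open_comp => // q _; exact: eps_continuous.
have mUA : measurable (U `\` A : set (borel (rcosets Gam))).
  by apply: measurableD => //; exact: borel_open.
have mUAi : measurable_fun setT (EFin \o (\1_(U `\` A) : borel (rcosets Gam) -> R)).
  by apply/measurable_EFinP; exact: measurable_indic.
have mU'Ai : measurable_fun setT (EFin \o (\1_(U' `\` A') : borel (lcosets Gam) -> R)).
  by apply/measurable_EFinP; apply: measurable_indic; exact: measurableD.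
exists U; split => //.
  by move=> q Aq; split; [exact: AV|apply: A'U'; rewrite /A' /= epsK].
rewrite -[X in nu X]setIT -(integral_indic nu measurableT)// nuE//.
apply: (@le_trans _ _ (\int[muGGam]_q (M%:E * (\1_(U' `\` A') q)%:E))).
  apply: ge0_le_integral => //.
  - move=> q _; apply: mule_ge0; rewrite lee_fin//; exact/ltW/coset_weight_gt0.
  - apply: emeasurable_funM; last first.
      by apply/measurable_EFinP; exact: measurable_coset_weight.
    exact: (measurableT_comp mUAi mepsV).
  - exact: emeasurable_funM.
  - move=> q _; rewrite !indicE.
    case: (boolP (eps_inv q \in U `\` A)) => [/set_mem[[Vq U'q] nAq]|_].
      rewrite mem_set; last by split => //; move: U'q; rewrite /= eps_invK.
      rewrite mule1 mul1e lee_fin; apply: MP; exists (eps_inv q); first exact: VK.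
      exact: eps_invK.
    by rewrite mul0e mule_ge0// lee_fin.
rewrite ge0_integralZl//.
rewrite integral_indic ?setIT//; last exact: measurableD.
apply: (@le_trans _ _ (M%:E * d%:E)); first by rewrite lee_wpmul2l// lee_fin.
rewrite -EFinM lee_fin /d mulrA ler_pdivrMr// mulrC.
by rewrite ler_pM2l// lerDl.
Qed.

Lemma right_measure_regular : regular_borel nu.
Proof.
split.
- exact: right_measure_compact.
- have [V [C [oV cC VC _ VT]]] := rcosets_open_exhaustion openT.
  apply: (outer_regular_exhaustion oV VT) => n A mA AV e e0.
  exact: (right_measure_outer_regular (oV n) (cC n) (VC n).1).
- move=> U oU; have [V [C [oV cC VC [_ ndC] VU]]] := rcosets_open_exhaustion oU.
  have mU : measurable (U : set (borel (rcosets Gam))) by exact: borel_open.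
  have mC (K : set (rcosets Gam)) : compact K ->
      measurable (K : set (borel (rcosets Gam))).
    by move=> cK; apply: borel_compact => //; exact: rcosets_hausdorff.
  have CU : \bigcup_n C n = U.
    apply/seteqP; split; first by apply: bigcup_sub => n _; exact: (VC n).2.
    by rewrite -[X in X `<=` _]VU; apply: subset_bigcup => n _; exact: (VC n).1.
  apply/eqP; rewrite eq_le; apply/andP; split; last first.
    apply: ge_ereal_sup => _ [K [cK KU] <-]; apply: le_measure; rewrite ?inE//.
    exact: mC.
  have cvC : nu \o C @ \oo --> nu U.
    rewrite -CU; apply: (@nondecreasing_cvg_mu _ (borel (rcosets Gam))) => //.
      by move=> n; exact: mC.
    by rewrite CU.
  rewrite -(cvg_lim _ cvC)//; apply: lime_le; first by apply/cvg_ex; exists (nu U).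
  apply: nearW => n; apply: ereal_sup_ubound; exists (C n) => //.
  by split => //; exact: (VC n).2.
Qed.

End right_measure.

(** * Uniqueness *)

(** The image of [A `*` B] under the bijection [right_orbit], described by its
    inverse so that its measurability is visible. *)
Definition right_box (A : set (rcosets Gam)) (B : set (csg_type Gam)) : set G :=
  [set x | A (\pi_(rcosets Gam) x) /\
           (val @` B) (x * (gamma (\pi_(rcosets Gam) x))^-1)%g].

Lemma right_boxP A B q (xi : csg_type Gam) :
  right_box A B (val xi * gamma q)%g <-> A q /\ B xi.
Proof.
rewrite /right_box /= right_orbit_pi mulgK; split => -[Aq].
  by move=> [b Bb /val_inj <-].
by move=> Bxi; split => //; exists xi.
Qed.

Lemma measurable_right_box (A : set (borel (rcosets Gam))) (B : set (csg_type Gam)) :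
  measurable A -> compact B -> measurable (right_box A B : set (borel G)).
Proof.
move=> mA cB.
have mpi : measurable_fun setT (\pi_(rcosets Gam) : borel G -> borel (rcosets Gam)).
  by apply: continuous_borel; exact: pi_continuous.
have mB : measurable (val @` B : set (borel G)).
  apply: borel_compact => //; apply: continuous_compact => //.
  by apply: continuous_subspaceT; exact: csg_val_continuous.
pose h (x : borel G) : borel G * borel G :=
  (x, (gamma (\pi_(rcosets Gam) x))^-1%g).
have mh : measurable_fun setT h.
  apply: measurable_fun_pair => //.
  exact: (measurableT_comp minvG (measurableT_comp measurable_right_section mpi)).
have mk := measurableT_comp (measurable_mulg second_countableG) mh.
apply: measurableI.
  by rewrite -[X in measurable X]setTI; exact: mpi.
by rewrite -[X in measurable X]setTI; exact: mk.
Qed.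

(** On the fiber over [q] the box is [B] if [q] is in [A] and empty otherwise, so
    its Haar measure is a product. The box lies in a compact set, which makes
    its indicator integrable. *)
Lemma right_box_value (nu : {measure set (borel (rcosets Gam)) -> \bar R})
    (K : set (rcosets Gam)) (A : set (borel (rcosets Gam)))
    (B : set (csg_type Gam)) :
  (forall K : set (rcosets Gam), compact K -> nu K < +oo) ->
  right_quotient_formula muG muGam gamma nu ->
  compact K -> A `<=` K -> measurable A -> compact B ->
  fine (muG (right_box A B)) = (fine (nu A) * fine (muGam B))%R.
Proof.
move=> nuoo formula cK AK mA cB.
have mE := measurable_right_box mA cB.
have mB : measurable (B : set (borel (csg_type Gam))).
  by apply: borel_compact => //; exact: csg_hausdorff.
have Boo : muGam B < +oo by case: haarGam => -[+ _ _] _ _; exact.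
have Aoo : nu A < +oo.
  apply: le_lt_trans (nuoo _ cK); apply: le_measure; rewrite ?inE//.
  by apply: borel_compact => //; exact: rcosets_hausdorff.
have [C cC CP] := right_orbit_compact cK cB.
have Eoo : muG (right_box A B) < +oo.
  apply: (@le_lt_trans _ _ (muG C)); last by case: haarG => -[+ _ _] _ _; exact.
  apply: le_measure; rewrite ?inE//; first exact: borel_compact.
  move=> x [Ax [b Bb bx]]; have := CP _ _ (AK _ Ax) Bb.
  by rewrite bx mulgVK.
have := formula _ (cintegrable_real (integrable_indic_lty mE Eoo)).
rewrite (@cintegral_real _ _ (borel G)).
under [X in cintegral nu X]eq_fun do
  rewrite (@cintegral_real _ _ (borel (csg_type Gam)) muGam).
rewrite (@cintegral_real _ _ (borel (rcosets Gam))) => -[].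
rewrite {1}/Rintegral integral_indic// setIT => ->.
have inner q : (\int[muGam]_xi (\1_(right_box A B) (val xi * gamma q)%g) =
    \1_A q * fine (muGam B))%R.
  rewrite /Rintegral indicE; case: (boolP (q \in A)) => [/set_mem Aq|Aq].
    rewrite mul1r -[X in muGam X]setIT -(integral_indic muGam measurableT)//.
    congr fine; apply: eq_integral => xi _; congr (_%:R)%:E.
    by congr nat_of_bool; apply/idP/idP => /set_mem H; apply/mem_set; move: H;
      rewrite right_boxP => //; case.
  rewrite mul0r integral0_eq// => xi _; rewrite indicE memNset//.
  by move=> /right_boxP[Aq' _]; case/negP: Aq; exact/mem_set.
under eq_Rintegral do rewrite inner.
rewrite /Rintegral; under eq_integral do rewrite EFinM.
rewrite ge0_integralZr//; last 2 first.
- by apply/measurable_EFinP; exact: measurable_indic.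
- by rewrite lee_fin fine_ge0.
by rewrite integral_indic// setIT fineM// ge0_fin_numE.
Qed.

Lemma right_measure_unique (nu1 nu2 : {measure set (borel (rcosets Gam)) -> \bar R}) :
  (forall K : set (rcosets Gam), compact K -> nu1 K < +oo) ->
  (forall K : set (rcosets Gam), compact K -> nu2 K < +oo) ->
  right_quotient_formula muG muGam gamma nu1 ->
  right_quotient_formula muG muGam gamma nu2 ->
  forall A : set (borel (rcosets Gam)), measurable A -> nu1 A = nu2 A.
Proof.
move=> nu1oo nu2oo formula1 formula2 A mA.
have [B cB B0] := haar_compact_gt0 haarGam.
have Boo : muGam B < +oo by case: haarGam => -[+ _ _] _ _; exact.
have [V [C [_ cC VC [_ ndC] VT]]] := rcosets_open_exhaustion openT.
have mC n : measurable (C n : set (borel (rcosets Gam))).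
  by apply: borel_compact => //; exact: rcosets_hausdorff.
have mAC n : measurable (A `&` C n) by exact: measurableI.
have nuAC (nu : {measure set (borel (rcosets Gam)) -> \bar R}) n :
    (forall K : set (rcosets Gam), compact K -> nu K < +oo) ->
    nu (A `&` C n) \is a fin_num.
  move=> nuoo; rewrite ge0_fin_numE//; apply: le_lt_trans (nuoo _ (cC n)).
  by apply: le_measure; rewrite ?inE.
have eqn n : nu1 (A `&` C n) = nu2 (A `&` C n).
  rewrite -[LHS]fineK ?nuAC// -[RHS]fineK ?nuAC//; congr EFin.
  apply: (@mulIf _ (fine (muGam B))); first by rewrite gt_eqF// fine_gt0// B0.
  by rewrite -!(@right_box_value _ (C n) _ B)//; exact: subIsetr.
have AC : \bigcup_n (A `&` C n) = A.
  rewrite -setI_bigcupr; apply/setIidPl => q _.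
  by move: (I : setT q); rewrite -VT => -[n _ Vq]; exists n => //; exact: (VC n).1.
have cv (nu : {measure set (borel (rcosets Gam)) -> \bar R}) :
    (fun n => nu (A `&` C n)) @ \oo --> nu A.
  rewrite -[in X in _ --> X]AC; apply: nondecreasing_cvg_mu => //.
    by rewrite AC.
  move=> n m nm; apply/subsetPset; apply: setIS; apply/subsetPset; exact: ndC.
have cv2 := cv nu2; rewrite -(funext eqn) in cv2.
exact: cvg_unique (cv nu1) cv2.
Qed.

End coset_integration.

(** * Assembling the theorem *)

(** Tonelli's theorem asks for bundled sigma-finite measures; the
    equality of measures allows the bundled version to be substituted
    throughout. *)
Lemma sigma_finite_measure_of (R : realType) d (T : measurableType d)
    (mu : {measure set T -> \bar R}) : sigma_finite setT mu ->
  exists nu : {sigma_finite_measure set T -> \bar R},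
    (nu : {measure set T -> \bar R}) = mu.
Proof.
move=> smu.
pose m1 := isSFinite.Build _ _ _ _ (sfinite_measure_sigma_finite smu).
pose m2 := isSigmaFinite.Build _ _ _ _ smu.
pose nu := HB.pack_for (SigmaFiniteMeasure.type T R) (Measure.sort mu) m1 m2.
by exists nu; exact: eq_measure.
Qed.

Lemma ReZ (R : realType) (z : R[i]) (r : R) :
  complex.Re (z * r%:C) = complex.Re z * r.
Proof. by case: z => a b /=; rewrite mulr0 subr0. Qed.

Lemma ImZ (R : realType) (z : R[i]) (r : R) :
  complex.Im (z * r%:C) = complex.Im z * r.
Proof. by case: z => a b /=; rewrite mulr0 add0r. Qed.

Unset Implicit Arguments.

Theorem theorem3p4 (R : realType) (G : topGroupType) (Gam : closedSubgroup G)
    (muG : {measure set (borel G) -> \bar R})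
    (muGam : {measure set (borel (csg_type Gam)) -> \bar R})
    (DeltaG : G -> R) (DeltaGam : csg_type Gam -> R) (rho : G -> R)
    (muGGam : {measure set (borel (lcosets Gam)) -> \bar R})
    (tau : lcosets Gam -> G)
    (hausdorffG : hausdorff_space G)
    (second_countableG : @second_countable G)
    (locally_compactG : locally_compact [set: G])
    (haarG : left_haar muG)
    (haarGam : left_haar muGam)
    (modularG : modular_function muG DeltaG)
    (modularGam : modular_function muGam DeltaGam)
    (rhoP : rho_function DeltaG DeltaGam rho)
    (rho1 : rho_function DeltaG DeltaGam (fun=> 1) -> rho = fun=> 1)
    (muGGam_regular : regular_borel muGGam)
    (muGGamP : quotient_formula muG muGam rho muGGam)
    (tauP : borel_section tau) :
  let gamma := right_section tau in
  exists nu : {measure set (borel (rcosets Gam)) -> \bar R},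
    [/\ regular_borel nu,
        right_quotient_formula muG muGam gamma nu,
        forall nu' : {measure set (borel (rcosets Gam)) -> \bar R},
          regular_borel nu' -> right_quotient_formula muG muGam gamma nu' ->
          forall A : set (borel (rcosets Gam)), measurable A -> nu' A = nu A,
        forall f : G -> R[i], cintegrable muG f ->
          let fgamma (q : borel (rcosets Gam)) (xi : borel (csg_type Gam)) :=
            f (val xi * gamma q)%g in
          [/\ {ae nu, forall q, cintegrable muGam (fgamma q)},
              cmeasurable (fun q => cintegral muGam (fgamma q))
            & cintegrable nu (fun q => cintegral muGam (fgamma q))]
      & forall f : rcosets Gam -> R[i], cintegrable nu f ->
          let g (q : borel (lcosets Gam)) : R[i] :=
            f (eps_inv q) * ((rho (tau q) * DeltaG (tau q))^-1)%:C in
          cintegrable muGGam g /\ cintegral nu f = cintegral muGGam g].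

Proof.
move=> gamma.
have [V [C [_ cC VC _ VT]]] :=
  open_exhaustion hausdorffG second_countableG locally_compactG openT.
have CT : \bigcup_n C n = setT.
  apply/seteqP; split => // x _; move: (I : setT x); rewrite -VT => -[n _ Vx].
  by exists n => //; exact: (VC n).1.
have [muG' eG] : exists m : {sigma_finite_measure set (borel G) -> \bar R},
    (m : {measure set (borel G) -> \bar R}) = muG.
  apply: sigma_finite_measure_of.
  by apply: (sigma_finite_exhaustion hausdorffG _ cC CT); case: haarG => -[].
subst muG.
have [muGam' eGam] :
    exists m : {sigma_finite_measure set (borel (csg_type Gam)) -> \bar R},
    (m : {measure set (borel (csg_type Gam)) -> \bar R}) = muGam.
  apply: sigma_finite_measure_of.
  apply: (@sigma_finite_exhaustion _ (csg_type Gam) _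
    (fun n => val @^-1` C n)).
  - exact: csg_hausdorff.
  - by case: haarGam => -[].
  - by move=> n; exact: csg_compact_preimage.
  - by rewrite -preimage_bigcup CT.
subst muGam.
have [muGGam' eGGam] :
    exists m : {sigma_finite_measure set (borel (lcosets Gam)) -> \bar R},
    (m : {measure set (borel (lcosets Gam)) -> \bar R}) = muGGam.
  apply: sigma_finite_measure_of.
  apply: (@sigma_finite_exhaustion _ (lcosets Gam) _
    (fun n => \pi_(lcosets Gam)%qT @` C n)).
  - exact: lcosets_hausdorff.
  - by case: muGGam_regular.
  - move=> n; apply: continuous_compact => //; apply: continuous_subspaceT.
    exact: pi_continuous.
  - rewrite -image_bigcup CT; apply/seteqP; split => // q _.
    by exists (repr q) => //; rewrite reprK.
subst muGGam.
have [nu0 nu0E] := right_measure_exists muGGam' second_countableG haarG modularG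
  rhoP tauP.
have smeasurable := right_measure_sigma_finite hausdorffG second_countableG
  locally_compactG haarG haarGam modularG modularGam rhoP muGGam_regular
  muGGamP tauP nu0E.
have [nu e] := sigma_finite_measure_of smeasurable; subst nu0.
have regular := right_measure_regular hausdorffG second_countableG
  locally_compactG haarG haarGam modularG modularGam rhoP muGGam_regular
  muGGamP tauP nu0E.
have mPhi := measurable_right_orbit second_countableG tauP.
have muGE (A : set (borel G)) : measurable A ->
    muG' A = (nu \x muGam')%E (right_orbit tau @^-1` A).
  move=> mA; rewrite (haar_right_formula hausdorffG second_countableG
    locally_compactG haarG haarGam modularG modularGam rhoP muGGam_regular
    muGGamP tauP nu0E)//.
  apply: eq_integral => q _ /=; congr (muGam' _).
  by apply/seteqP; split => xi; rewrite xsectionE.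
have formula : right_quotient_formula muG' muGam' gamma nu.
  move=> f [fRe fIm]; rewrite /cintegral.
  by congr (_ +i* _); exact: (disintegration_integral mPhi muGE).
have [compact_lty _ _] := regular.
exists nu; split => //.
- move=> nu' [nu'lty _ _] formula' A mA.
  exact: (right_measure_unique hausdorffG second_countableG locally_compactG
    haarG haarGam tauP nu'lty compact_lty formula' formula mA).
- move=> f [fRe fIm] fgamma; split.
  + have := disintegration_ae mPhi muGE fIm.
    by apply: filterS2 (disintegration_ae mPhi muGE fRe) => q qRe qIm; split.
  + split; first exact: (disintegration_measurable mPhi muGE fRe).
    exact: (disintegration_measurable mPhi muGE fIm).
  + split; first exact: (disintegration_integrable mPhi muGE fRe).
    exact: (disintegration_integrable mPhi muGE fIm).
- move=> f [fRe fIm] g.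
  have meps : measurable_fun setT
      (@eps_inv G Gam : borel (lcosets Gam) -> borel (rcosets Gam)).
    by apply: continuous_borel; exact: eps_inv_continuous.
  have mw := measurable_coset_weight second_countableG haarG modularG rhoP tauP.
  have w0 q : 0 <= coset_weight DeltaG rho tau q.
    by apply/ltW; exact: (coset_weight_gt0 tau modularG rhoP).
  have [gRe eRe] := integral_transfer meps mw w0 nu0E fRe.
  have [gIm eIm] := integral_transfer meps mw w0 nu0E fIm.
  have ReE q : complex.Re (g q) =
      complex.Re (f (eps_inv q)) * coset_weight DeltaG rho tau q by exact: ReZ.
  have ImE q : complex.Im (g q) =
      complex.Im (f (eps_inv q)) * coset_weight DeltaG rho tau q by exact: ImZ.
  split.
    split; first by rewrite (funext ReE).
    by rewrite (funext ImE).
  rewrite /cintegral (funext ReE) (funext ImE) /Rintegral.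
  by congr (_ +i* _); congr fine.
Qed.
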